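(* Let $n\geq 1$ be an integer, $\mu\in\mathbb R$, and $\alpha,\beta\in\mathbb R$. Equip $\mathbb R^{2n+1}=\mathbb R^n\times\mathbb R^n\times\mathbb R$ with the multiplication law \[(u,v,t)\odot(\xi,\eta,\tau)=\big(u+\xi,\ v+\eta,\ t+\tau+\mu(u\cdot\eta-v\cdot\xi)\big),\qquad (\xi,\eta,\tau)^{-1}=(-\xi,-\eta,-\tau).\] Let $\mathbf V^{\alpha\beta}$ be the distribution on $\mathbb R^{2n+1}$ which agrees, for $u\neq 0$, $v\neq0$, $t\neq 0$, with the function \[\mathbf V^{\alpha\beta}(u,v,t)=|u|^{\alpha-n}|v|^{\alpha-n}|t|^{\beta-1}\left[\frac{|u||v|}{|t|}+\frac{|t|}{|u||v|}\right]^{-\rho},\qquad \rho=\frac{|\alpha-n\beta|}{n+1},\] and define \[\mathbf I_{\alpha\beta}f(u,v,t)=\iiint_{\mathbb R^{2n+1}} f(\xi,\eta,\tau)\,\mathbf V^{\alpha\beta}\big[(u,v,t)\odot(\xi,\eta,\tau)^{-1}\big]\,d\xi\,d\eta\,d\tau .\] Let $1<p<q<\infty$. Then there is a constant $\mathfrak B_{p\,q}>0$ such that \[\|\mathbf I_{\alpha\beta}f\|_{L^q(\mathbb R^{2n+1})}\leq \mathfrak B_{p\,q}\,\|f\|_{L^p(\mathbb R^{2n+1})}\quad\text{for all } f\in L^p(\mathbb R^{2n+1})\] if and only if $\dfrac{\alpha+\beta}{n+1}=\dfrac1p-\dfrac1q$.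
   Context: Here $|\cdot|$ denotes the Euclidean norm on $\mathbb R^n$ (absolute value on $\mathbb R$), and $u\cdot\eta$ the Euclidean inner product on $\mathbb R^n$. The constant $\mathfrak B_{p\,q}$ may depend on $p,q$ (and the fixed data $n,\alpha,\beta,\mu$) but not on $f$. *)

(* Defs.v *)
From HB Require Import structures.
From mathcomp Require Import all_boot all_order all_algebra.
From mathcomp Require Import all_classical all_reals all_analysis.
Set Implicit Arguments. Unset Strict Implicit. Unset Printing Implicit Defensive.
Import Order.TTheory GRing.Theory Num.Theory.
Import numFieldNormedType.Exports.
Local Open Scope classical_set_scope.
Local Open Scope ring_scope.

Definition pt (R : realType) (n : nat) : Type := (n.-tuple R * n.-tuple R * R)%type.

Definition enorm (R : realType) (n : nat) (u : n.-tuple R) : R :=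
  Num.sqrt (\sum_(i < n) tnth u i ^+ 2).
Definition edot (R : realType) (n : nat) (u w : n.-tuple R) : R :=
  \sum_(i < n) tnth u i * tnth w i.
Definition tadd (R : realType) (n : nat) (u w : n.-tuple R) : n.-tuple R :=
  [tuple tnth u i + tnth w i | i < n].
Definition topp (R : realType) (n : nat) (u : n.-tuple R) : n.-tuple R :=
  [tuple - tnth u i | i < n].

Definition gmul (R : realType) (n : nat) (mu : R) (x y : pt R n) : pt R n :=
  let: (u, v, t) := x in let: (xi, eta, tau) := y in
  (tadd u xi, tadd v eta, t + tau + mu * (edot u eta - edot v xi)).
Definition ginv (R : realType) (n : nat) (y : pt R n) : pt R n :=
  let: (xi, eta, tau) := y in (topp xi, topp eta, - tau).

(* The kernel V^{alpha beta}; on the null set {u = 0 or v = 0 or t = 0}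
   it is set to 0 (irrelevant for the integral). *)
Definition rho (R : realType) (n : nat) (alpha beta : R) : R :=
  `|alpha - n%:R * beta| / (n%:R + 1).
Definition Vker (R : realType) (n : nat) (alpha beta : R) (x : pt R n) : R :=
  let: (u, v, t) := x in
  if (enorm u != 0) && (enorm v != 0) && (t != 0) then
    powR (enorm u) (alpha - n%:R) * powR (enorm v) (alpha - n%:R)
    * powR `|t| (beta - 1)
    * powR (enorm u * enorm v / `|t| + `|t| / (enorm u * enorm v))
           (- rho n alpha beta)
  else 0.

(* Lebesgue integral over R^n, as the n-fold iterated Lebesgue integral
   over R (Tonelli/Fubini: agrees with the product Lebesgue integral). *)
Fixpoint iint (R : realType) (n : nat) : (n.-tuple R -> \bar R) -> \bar R :=
  match n return (n.-tuple R -> \bar R) -> \bar R with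
  | 0 => fun F => F [tuple]
  | k.+1 => fun F =>
      (\int[@lebesgue_measure R]_x iint (fun w => F (cons_tuple x w)))%E
  end.

Definition intP (R : realType) (n : nat) (F : pt R n -> \bar R) : \bar R :=
  iint (fun u => iint (fun v =>
     (\int[@lebesgue_measure R]_t F (u, v, t))%E)).

Definition LnormP (R : realType) (n : nat) (r : R) (F : pt R n -> \bar R)
  : \bar R :=
  ((intP (fun x => `|F x| `^ r)) `^ r^-1)%E.

Definition Iop (R : realType) (n : nat) (mu alpha beta : R) (f : pt R n -> R)
  (x : pt R n) : \bar R :=
  intP (fun y => (f y * Vker alpha beta (gmul mu x (ginv y)))%:E).

(* Main.v *)
Require Import Defs.
From HB Require Import structures.
From mathcomp Require Import all_boot all_order all_algebra.
From mathcomp Require Import all_classical all_reals all_analysis.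
From mathcomp Require Import measurable_realfun ring lra.
Import Order.TTheory GRing.Theory Num.Theory.
Import numFieldNormedType.Exports.
Set Implicit Arguments.
Unset Strict Implicit.
Unset Printing Implicit Defensive.
Local Open Scope classical_set_scope.
Local Open Scope ring_scope.

(** Put g = (alpha + beta) / (n + 1).

    Sufficiency.  Since (a + 1/a)^(-|s|) <= a^(-s) and g < 1, the kernel is at
    most the product of |x|^(g-1) over all 2n+1 coordinates x.  Minkowski's
    integral inequality then peels off one variable at a time (the group twist
    is a translation in the last variable, which the L^q norm does not see), so
    that only the one-dimensional Hardy-Littlewood-Sobolev inequality is left.
    For the latter, normalize the L^p norm of f to 1.  At level s, cut the
    kernel at radius r ~ s^(-q), so that by Hoelder its far part contributes at
    most s/2, and cut f at height h ~ s^(q/p), so that the near part of the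
    kernel against f 1_{f <= h} contributes at most s/4.  Chebyshev's inequality
    for the rest gives h |{Tf > s}| <= \int f 1_{f > h}, and integrating against
    q s^(q-1) ds bounds \int (Tf)^q by a multiple of \int f^p.

    Necessity.  Test on the indicator of the box of sides l (horizontal) and
    l^2 (vertical): on a translate of this box the operator returns at least
    c l^(2(alpha+beta)), and letting l range over all positive reals forces the
    exponents to balance. *)

Lemma le_poweR (R : realType) (r : R) (x y : \bar R) :
  0 <= r -> (0 <= x)%E -> (x <= y)%E -> (x `^ r <= y `^ r)%E.
Proof.
move=> r0 x0 xy; apply: gt0_ler_poweR => //; rewrite in_itv/= leey andbT//.
exact: le_trans xy.
Qed.

(** * Integral inequalities valid for arbitrary functions *)

Section nonmeasurable.
Local Open Scope ereal_scope.
Context d (T : measurableType d) (R : realType) (mu : {measure set T -> \bar R}).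

(* Integrals of nonnegative functions are suprema over simple functions below, so
   no measurability is needed here; the measurability of [Vker] thus never matters. *)
Lemma ge0_le_integralT (f g : T -> \bar R) :
  (forall x, 0 <= f x) -> (forall x, f x <= g x) ->
  \int[mu]_x f x <= \int[mu]_x g x.
Proof.
move=> f0 fg; have g0 x : 0 <= g x by exact: le_trans (f0 x) (fg x).
rewrite !ge0_integralTE//; apply: ge_ereal_sup => _ [h /= hf <-].
by apply: ereal_sup_ubound; exists h => // x; exact: le_trans (hf x) (fg x).
Qed.

(** The integrals of [f^\+] and [f^\-] both lie between 0 and that of [|f|], so their difference
    does so up to sign; if both are infinite, so is the right-hand side. *)
Lemma abse_integral_leT (f : T -> \bar R) :
  `|\int[mu]_x f x| <= \int[mu]_x `|f x|.
Proof.
rewrite integralE.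
have : \int[mu]_x f^\+ x <= \int[mu]_x `|f x|.
  apply: ge0_le_integralT => x; first exact: funepos_ge0.
  by rewrite funeposE ge_max abse_ge0 lee_abs.
have : \int[mu]_x f^\- x <= \int[mu]_x `|f x|.
  apply: ge0_le_integralT => x; first exact: funeneg_ge0.
  by rewrite funenegE ge_max abse_ge0 -abseN lee_abs.
have : 0 <= \int[mu]_x f^\+ x by exact: integral_ge0.
have : 0 <= \int[mu]_x f^\- x by exact: integral_ge0.
move: (\int[mu]_x f^\+ x) (\int[mu]_x f^\- x) (\int[mu]_x `|f x|).
move=> [a| |] [b| |] [c| |] //=; rewrite ?lee_fin ?leey// => b0 a0 bc ac.
rewrite ler_norml; apply/andP; split; first by rewrite lerBrDr (le_trans _ a0)// addrC subr_le0.
by rewrite lerBlDr (le_trans ac)// lerDl.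
Qed.

End nonmeasurable.

(** * Translation and reflection on the line *)

Section translation.
Local Open Scope ereal_scope.
Context (R : realType).
Local Notation mu := (@lebesgue_measure R).

(** The pushforward of Lebesgue measure by the translation gives half-open intervals their length,
    so by uniqueness it is Lebesgue measure again. *)
Lemma integral_shift (c : R) (f : R -> \bar R) :
  measurable_fun [set: R] f -> (forall r, 0 <= f r) ->
  \int[mu]_y f (y + c)%R = \int[mu]_y f y.
Proof.
move=> mf f0.
pose phi : measurableTypeR R -> measurableTypeR R := fun y => (y + c)%R.
have mphi : measurable_fun setT phi by exact: measurable_funD.
have /(_ setT f measurableT mf) := @ge0_integral_pushforward _ _ _ _ R phi mphi mu.
rewrite preimage_setT => <-//.
apply: eq_measure_integral => //= A mA _; apply/esym.
apply: lebesgue_measure_unique => //= _ [[a b]] _ <-.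
rewrite /pushforward.
rewrite (_ : phi @^-1` _ = `](a - c)%R, (b - c)%R]%classic); last first.
  apply/seteqP; split => y /=; rewrite !in_itv/= /phi ltrBlDr lerBrDr//.
rewrite !lebesgue_measure_itv/= !lte_fin ltrBlDr subrK.
by case: ifP => // _; rewrite -!EFinD; congr EFin; rewrite opprB addrC addrA subrK addrC.
Qed.

Lemma integral_reflect (c : R) (f : R -> \bar R) :
  measurable_fun [set: R] f -> (forall r, 0 <= f r) ->
  \int[mu]_y f (c - y)%R = \int[mu]_y f y.
Proof.
move=> mf f0.
pose phi : measurableTypeR R -> measurableTypeR R := fun y => (- y)%R.
have mphi : measurable_fun setT phi by exact: oppr_measurable.
have /(_ setT (fun y => f (y + c)%R) measurableT) := @ge0_integral_pushforward _ _ _ _ R phi mphi mu.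
rewrite preimage_setT => E.
rewrite -[RHS](integral_shift c)//.
transitivity (\int[pushforward mu phi]_y f (y + c)%R).
  rewrite E//; last by apply: measurableT_comp => //; exact: measurable_funD.
  by apply: eq_integral => x _ /=; rewrite addrC.
by apply: eq_measure_integral => //= A mA _; exact: lebesgue_measureN.
Qed.

End translation.

(** * Hölder's inequality for nonnegative extended-real functions *)

Section hoelder.
Local Open Scope ereal_scope.
Context d (T : measurableType d) (R : realType) (mu : {measure set T -> \bar R}).

Lemma measurable_fun_poweR (f : T -> \bar R) (p : R) :
  measurable_fun [set: T] f -> measurable_fun [set: T] (fun x => f x `^ p).
Proof.
exact: (@measurableT_comp _ _ _ _ _ _ (@poweR R ^~ p)) (measurable_poweR p).
Qed.

Lemma ae_fin_num_poweR (f : T -> \bar R) (p : R) : (0 < p)%R ->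
  measurable_fun [set: T] f -> (forall x, 0 <= f x) ->
  \int[mu]_x (f x `^ p) < +oo -> {ae mu, forall x, f x \is a fin_num}.
Proof.
move=> p0 mf f0 foo.
have mfp := measurable_fun_poweR p mf.
have /integrable_ae : mu.-integrable setT (fun x => f x `^ p).
  apply/integrableP; split=> //.
  by under eq_integral do rewrite gee0_abs ?poweR_ge0//.
move=> /(_ measurableT); apply: filterS => x /(_ I).
case: (f x) (f0 x) => //=; by rewrite gt_eqF.
Qed.

(** Once the cases of a zero or infinite norm are settled, both functions are finite almost
    everywhere, and the real-valued [hoelder] applies to [fine \o f] and [fine \o g]. *)
Lemma ge0_hoelder (f g : T -> \bar R) (p q : R) :
  measurable_fun [set: T] f -> measurable_fun [set: T] g ->
  (forall x, 0 <= f x) -> (forall x, 0 <= g x) ->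
  (0 < p)%R -> (0 < q)%R -> (p^-1 + q^-1 = 1)%R ->
  \int[mu]_x (f x * g x) <=
  (\int[mu]_x (f x `^ p)) `^ p^-1 * (\int[mu]_x (g x `^ q)) `^ q^-1.
Proof.
move=> mf mg f0 g0 p0 q0 pq.
(* A function with vanishing norm is zero almost everywhere, hence so is its product with [k], even
   where [k] is infinite, since [0 * +oo = 0]. *)
have zero (h k : T -> \bar R) (r : R) : (0 < r)%R -> measurable_fun [set: T] h -> measurable_fun [set: T] k ->
    (forall x, 0 <= h x) -> (forall x, 0 <= k x) ->
    \int[mu]_x (h x `^ r) = 0 -> \int[mu]_x (h x * k x) = 0.
  move=> r0 mh mk h0 k0 hr.
  have /ae_eq_integral_abs : measurable_fun [set: T] (fun x => h x `^ r) by exact: measurable_fun_poweR.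
  move=> /(_ mu measurableT)[+ _].
  under eq_integral do rewrite gee0_abs ?poweR_ge0//.
  move=> /(_ hr) hr0.
  rewrite (ae_eq_integral (cst 0)) ?integral0//.
    exact: emeasurable_funM.
  apply: filterS hr0 => x /= /(_ I) hx _.
  by rewrite (poweR_eq0_eq0 (h0 x) hx) mul0e.
have int0 (h : T -> \bar R) (r : R) : 0 <= \int[mu]_x (h x `^ r).
  by apply: integral_ge0 => x _; exact: poweR_ge0.
have [/(zero _ g _ p0 mf mg f0 g0) ->|nf] := eqVneq (\int[mu]_x (f x `^ p)) 0.
  by rewrite mule_ge0 ?poweR_ge0.
have [/(zero _ f _ q0 mg mf g0 f0)|ng] := eqVneq (\int[mu]_x (g x `^ q)) 0.
  by under eq_integral do rewrite muleC; move=> ->; rewrite mule_ge0 ?poweR_ge0.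
have pf : 0 < (\int[mu]_x (f x `^ p)) `^ p^-1 by rewrite poweR_gt0// lt0e nf int0.
have pg : 0 < (\int[mu]_x (g x `^ q)) `^ q^-1 by rewrite poweR_gt0// lt0e ng int0.
have [fy|fy] := eqVneq (\int[mu]_x (f x `^ p)) +oo.
  by rewrite fy poweRyr ?gt_eqF ?invr_gt0// gt0_mulye ?leey.
have [gy|gy] := eqVneq (\int[mu]_x (g x `^ q)) +oo.
  by rewrite gy poweRyr ?gt_eqF ?invr_gt0// gt0_muley ?leey.
have ff := ae_fin_num_poweR p0 mf f0 (ltac:(by rewrite ltey)).
have gf := ae_fin_num_poweR q0 mg g0 (ltac:(by rewrite ltey)).
have mff : measurable_fun [set: T] (fine \o f) by exact: measurableT_comp.
have mgf : measurable_fun [set: T] (fine \o g) by exact: measurableT_comp.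
have := hoelder mu mff mgf p0 q0 pq; rewrite Lnorm1 !Lnorm.unlock.
have cong (h : T -> \bar R) (r : R) : (0 < r)%R -> measurable_fun [set: T] h ->
    (forall x, 0 <= h x) -> {ae mu, forall x, h x \is a fin_num} ->
    \int[mu]_x (`|(fine (h x))%:E| `^ r) = \int[mu]_x (h x `^ r).
  move=> r0 mh h0 hf; apply: ae_eq_integral => //; [|exact: measurable_fun_poweR|].
    apply: measurable_fun_poweR; apply: measurableT_comp => //; apply/measurable_EFinP; exact: measurableT_comp.
  by apply: filterS hf => x hx _; rewrite fineK// gee0_abs.
rewrite (cong f p)// (cong g q)//; apply: le_trans.
rewrite (ae_eq_integral (fun x => `|(fine (f x) * fine (g x))%:E|))//.
- exact: emeasurable_funM.
- apply: measurableT_comp => //; apply/measurable_EFinP; exact: measurable_funM.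
- apply: filterS2 ff gf => x fx gx _.
  by rewrite EFinM !fineK// gee0_abs// mule_ge0.
Qed.

End hoelder.

(** * Minkowski's integral inequality *)

Section minkowski.
Local Open Scope ereal_scope.
Context d1 d2 (X : measurableType d1) (Y : measurableType d2) (R : realType).
Variables (mu : {sigma_finite_measure set X -> \bar R})
  (nu : {sigma_finite_measure set Y -> \bar R}).
Variables (F : X * Y -> \bar R) (q : R).
Hypotheses (mF : measurable_fun [set: X * Y] F) (F0 : forall z, 0 <= F z).
Hypothesis q1 : (1 < q)%R.

Let S x := \int[nu]_y F (x, y).
Let A := \int[nu]_y (\int[mu]_x (F (x, y) `^ q)) `^ q^-1.

Let S0 x : 0 <= S x. Proof. exact: integral_ge0. Qed.

Let A0 : 0 <= A. Proof. by apply: integral_ge0 => y _; exact: poweR_ge0. Qed.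

Let q0 : (0 < q)%R. Proof. exact: lt_trans q1. Qed.

Let mA : measurable_fun [set: Y] (fun y => (\int[mu]_x (F (x, y) `^ q)) `^ q^-1).
Proof.
apply: measurable_fun_poweR.
apply: (measurable_fun_fubini_tonelli_G (fun z => F z `^ q)).
  exact: measurable_fun_poweR.
by move=> z; exact: poweR_ge0.
Qed.

(** With r conjugate to q, G = G^(1/r) G^(1/q) <= G^(1/r) S. Tonelli and Hölder in x for each y then
    give I <= I^(1/r) A for I the integral of G. The finiteness of I allows division by I^(1/r),
    which is why the bound is first proved for minorants of S^q. *)
Let minkowski_fin (G : X -> \bar R) : measurable_fun [set: X] G ->
  (forall x, 0 <= G x) -> (forall x, G x <= S x `^ q) ->
  \int[mu]_x G x < +oo -> \int[mu]_x G x <= A `^ q.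
Proof.
move=> mG G0 GS Goo.
pose r := (q / (q - 1))%R.
have q10 : (0 < q - 1)%R by rewrite subr_gt0.
have r0 : (0 < r)%R by rewrite divr_gt0.
have rq : (r^-1 + q^-1 = 1)%R.
  by rewrite /r invf_div mulrBl mul1r divff ?gt_eqF// subrK.
have IG0 : 0 <= \int[mu]_x G x by exact: integral_ge0.
have mGr : measurable_fun [set: X] (fun x => G x `^ r^-1) by exact: measurable_fun_poweR.
have mF2 y : measurable_fun [set: X] (fun x => F (x, y)) by exact: measurableT_comp.
have mF1 x : measurable_fun [set: Y] (fun y => F (x, y)) by exact: measurableT_comp.
have H : \int[mu]_x G x <= (\int[mu]_x G x) `^ r^-1 * A.
  apply: (@le_trans _ _ (\int[mu]_x (G x `^ r^-1 * S x))).
    apply: ge0_le_integralT => // x.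
    rewrite -[leLHS](poweRe1 (G0 x)) -rq poweRD; last first.
      by apply: add_neq0_poweRD_def; rewrite rq oner_neq0.
    apply: lee_pmul; rewrite ?poweR_ge0//.
    have /(_ (ltac:(by rewrite invr_ge0 ltW))) := le_poweR (r := q^-1) _ (G0 x) (GS x).
    by rewrite -poweRrM divff ?gt_eqF// poweRe1.
  under eq_integral do rewrite /S -ge0_integralZl// ?poweR_ge0//.
  rewrite (fubini_tonelli (fun z => G z.1 `^ r^-1 * F z))//; last 2 first.
  - apply: emeasurable_funM => //; apply: measurable_fun_poweR; exact: measurableT_comp.
  - by move=> z; rewrite mule_ge0 ?poweR_ge0.
  rewrite -ge0_integralZl// ?poweR_ge0//; last by move=> y _; exact: poweR_ge0.
  apply: ge0_le_integralT => y; first by apply: integral_ge0 => x _; rewrite mule_ge0 ?poweR_ge0.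
  have := ge0_hoelder mu mGr (mF2 y) (fun x => poweR_ge0 _ _) (fun x => F0 _) r0 q0 rq.
  rewrite (_ : \int[mu]_x (G x `^ r^-1) `^ r = \int[mu]_x G x)//.
  by apply: eq_integral => x _; rewrite -poweRrM mulVf ?gt_eqF// poweRe1.
(* Cancelling the factor with exponent [r^-1] in [H] needs the integral to be nonzero as well as
   finite. *)
have [->|G1] := eqVneq (\int[mu]_x G x) 0; first exact: poweR_ge0.
have fG : \int[mu]_x G x \is a fin_num by rewrite ge0_fin_numE.
have HG : (\int[mu]_x G x) `^ q^-1 <= A.
  have: (\int[mu]_x G x) `^ r^-1 * (\int[mu]_x G x) `^ q^-1 <= (\int[mu]_x G x) `^ r^-1 * A.
    rewrite -poweRD; first by rewrite rq poweRe1.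
    by apply: add_neq0_poweRD_def; rewrite rq oner_neq0.
  rewrite lee_pmul2l//; first by rewrite fin_num_poweR.
  by rewrite poweR_gt0// lt0e G1.
have := le_poweR (ltW q0) (poweR_ge0 _ _) HG.
by rewrite -poweRrM mulVf ?gt_eqF// poweRe1.
Qed.

Import HBNNSimple.

(** The integral of S^q is a supremum over simple functions h below it. Cutting h to sets of finite
    measure that exhaust X makes its integral finite, so [minkowski_fin] applies, and monotone
    convergence removes the cut. *)
Lemma minkowski_integral :
  (\int[mu]_x (\int[nu]_y F (x, y)) `^ q) `^ q^-1 <=
  \int[nu]_y (\int[mu]_x (F (x, y) `^ q)) `^ q^-1.
Proof.
have H : \int[mu]_x (S x `^ q) <= A `^ q.
  rewrite ge0_integralTE => [|x]; last exact: poweR_ge0.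
  apply: ge_ereal_sup => _ [h /= hS <-].
  have /sigma_finiteP[E [ET ndE mE]] := @sigma_finiteT _ _ _ mu.
  rewrite -integralT_nnsfun ET.
  have mh : measurable_fun [set: X] (EFin \o h) by exact/measurable_EFinP.
  have h0 x : 0 <= (EFin \o h) x by rewrite /= lee_fin.
  have /cvg_lim <- // := @ge0_nondecreasing_set_cvg_integral _ _ _ E (EFin \o h) mu
    ndE (fun i => (mE i).1) (fun i => measurable_funTS mh) (fun i x _ => h0 x).
  apply: lime_le.
    apply: ereal_nondecreasing_is_cvgn.
    exact: (@ge0_nondecreasing_set_nondecreasing_integral _ _ _ E (EFin \o h) mu
    ndE (fun i => (mE i).1) (fun i => measurable_funTS mh) (fun i x _ => h0 x)).
  apply: nearW => i.
  rewrite integral_mkcond; apply: minkowski_fin.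
  - by apply/(measurable_restrictT _ _).1 => //; [exact: (mE i).1|exact: measurable_funTS].
  - by move=> x; apply: erestrict_ge0.
  - move=> x; rewrite /patch; case: ifP => _; [exact: hS|exact: poweR_ge0].
  - rewrite -integral_mkcond.
    (* A simple function is bounded, so its integral over a set of finite measure is finite. *)
    have [M hM] : exists M : R, forall x, (h x <= M)%R.
      have [M [_ HM]] := simple_bounded h.
      exists (M + 1)%R => x; apply: le_trans (ler_norm _) _; apply: HM => //.
      by rewrite ltrDl.
    apply: (@le_lt_trans _ _ (\int[mu]_(x in E i) (cst (M%:E)) x)).
      apply: ge0_le_integral => //; [exact: (mE i).1|exact: measurable_funTS|].
      by move=> x _; rewrite lee_fin.
    rewrite integral_cst; last exact: (mE i).1.
    apply: lte_mul_pinfty => //; last exact: (mE i).2.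
    by rewrite lee_fin (le_trans _ (hM point)).
have /(_ (ltac:(by rewrite invr_ge0 ltW))) := le_poweR (r := q^-1) _ (integral_ge0 _ (fun x _ => poweR_ge0 _ _)) H.
by rewrite -[(A `^ q) `^ _]poweRrM divff ?gt_eqF// poweRe1.
Qed.

End minkowski.

(** * Tonelli, Hölder and Minkowski on the real line *)

Section lebesgue_specializations.
Local Open Scope ereal_scope.
Context (R : realType).
Local Notation mu := (@lebesgue_measure R).

Lemma measurable_fun_integral d (T : measurableType d) (F : T -> R -> \bar R) :
  (forall z y, 0 <= F z y) ->
  measurable_fun [set: T * R] (fun z => F z.1 z.2) ->
  measurable_fun [set: T] (fun z => \int[mu]_y F z y).
Proof.
move=> F0 mF.
have := @measurable_fun_fubini_tonelli_F _ _ T (measurableTypeR R) R mu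
  (fun z => F z.1 z.2) mF.
by apply=> z; exact: F0.
Qed.

Lemma integral_swap (F : R -> R -> \bar R) :
  (forall x y, 0 <= F x y) ->
  measurable_fun [set: R * R] (fun z => F z.1 z.2) ->
  \int[mu]_x \int[mu]_y F x y = \int[mu]_y \int[mu]_x F x y.
Proof.
move=> F0 mF.
have := @fubini_tonelli _ _ (measurableTypeR R) (measurableTypeR R) R mu mu
  (fun z => F z.1 z.2) mF.
by apply=> z; exact: F0.
Qed.

Lemma hoelder_lebesgue (f g : R -> \bar R) (p q : R) :
  measurable_fun [set: R] f -> measurable_fun [set: R] g ->
  (forall x, 0 <= f x) -> (forall x, 0 <= g x) ->
  (0 < p)%R -> (0 < q)%R -> (p^-1 + q^-1 = 1)%R ->
  \int[mu]_x (f x * g x) <=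
  (\int[mu]_x (f x `^ p)) `^ p^-1 * (\int[mu]_x (g x `^ q)) `^ q^-1.
Proof. exact: (@ge0_hoelder _ (measurableTypeR R) R mu). Qed.

Lemma minkowski_lebesgue (F : R -> R -> \bar R) (q : R) : (1 < q)%R ->
  (forall x y, 0 <= F x y) ->
  measurable_fun [set: R * R] (fun z => F z.1 z.2) ->
  (\int[mu]_x (\int[mu]_y F x y) `^ q) `^ q^-1 <=
  \int[mu]_y (\int[mu]_x (F x y `^ q)) `^ q^-1.
Proof.
move=> q1 F0 mF.
have := @minkowski_integral _ _ (measurableTypeR R) (measurableTypeR R) R mu mu
  (fun z => F z.1 z.2) q mF.
by apply=> // z; exact: F0.
Qed.

End lebesgue_specializations.

(** * Integrals of powers over intervals *)

Section power_integrals.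
Context (R : realType).
Local Notation mu := (@lebesgue_measure R).

Lemma continuous_powR (e x : R) : 0 < x -> {for x, continuous (@powR R ^~ e)}.
Proof.
move=> x0; apply: differentiable_continuous; apply/derivable1_diffP.
by apply: derivable_powR; rewrite in_itv/= x0.
Qed.

Lemma integral_powR_itvcc (e a b : R) : e != 0 -> 0 < a -> a < b ->
  (\int[mu]_(s in `[a, b]) (s `^ (e - 1))%:E = ((b `^ e - a `^ e) / e)%:E)%E.
Proof.
move=> e0 a0 ab.
pose F (x : R) : R := e^-1 * x `^ e.
have dF x : 0 < x -> derivable F x 1.
  move=> x0; apply: derivableM => //; apply: derivable_powR.
  by rewrite in_itv/= x0.
have cF x : 0 < x -> {for x, continuous F}.
  by move=> x0; apply: differentiable_continuous; apply/derivable1_diffP; exact: dF.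
rewrite (@continuous_FTC2 _ _ F)//.
- by rewrite /F -EFinB -mulrBr mulrC.
- apply: continuous_in_subspaceT => x; rewrite inE/= in_itv/= => /andP[ax _].
  by apply: continuous_powR; exact: lt_le_trans ax.
- split=> [x|  |].
  + by rewrite in_itv/= => /andP[ax _]; apply: dF; exact: lt_trans ax.
  + by apply: cvg_at_right_filter; exact: cF.
  + by apply: cvg_at_left_filter; apply: cF; exact: lt_trans ab.
- move=> x; rewrite in_itv/= => /andP[ax _].
  have x0 : 0 < x by exact: lt_trans ax.
  have xi : x \in `]0, +oo[ by rewrite in_itv/= x0.
  rewrite derive1E deriveM//; last exact: derivable_powR.
  rewrite derive_cst scaler0 addr0 -derive1E powR_derive1//.
  by rewrite /GRing.scale/= mulrA mulVf// mul1r.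
Qed.

Lemma measurable_powR_EFin (e : R) (D : set R) :
  measurable_fun D (fun s : R => (s `^ e)%:E).
Proof. by apply: measurable_funTS; apply/measurable_EFinP; exact: measurable_powR. Qed.

Lemma integral_powR_itv0c (e a : R) : 0 < e -> 0 < a ->
  (\int[mu]_(s in `]0%R, a]) (s `^ (e - 1))%:E = (a `^ e / e)%:E)%E.
Proof.
move=> e0 a0.
(* The denominator starts at 2 so that every interval is nondegenerate, as [integral_powR_itvcc]
   demands. *)
pose E (i : nat) : set (measurableTypeR R) := `[a / i.+2%:R, a]%classic.
have -> : `]0, a]%classic = \bigcup_i E i.
  apply/seteqP; split => x /=; rewrite in_itv/=.
    move=> /andP[x0 xa]; exists (Num.truncn (a / x)) => //.
    rewrite /E/= in_itv/= xa andbT ler_pdivrMr// -ler_pdivrMl// mulrC.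
    have : a / x < (Num.truncn (a / x)).+1%:R.
      by rewrite truncnS_gt// divr_ge0// ltW.
    by move=> /ltW /le_trans; apply; rewrite ler_nat.
  move=> [i _]; rewrite /E/= in_itv/= => /andP[ax ->]; rewrite andbT.
  by apply: lt_le_trans ax; rewrite divr_gt0.
have ndE : nondecreasing_seq E.
  move=> i j ij; rewrite subsetEset => x; rewrite /E/= !in_itv/= => /andP[ax ->].
  rewrite andbT; apply: le_trans ax; rewrite ler_pM2l// lef_pV2 ?posrE//.
  by rewrite ler_nat !ltnS.
have H := @ge0_nondecreasing_set_cvg_integral _ _ _ E
  (fun s : measurableTypeR R => ((s : R) `^ (e - 1))%:E) mu ndE (fun i => measurable_itv _)
  (fun i => @measurable_powR_EFin _ _)
  (fun i x _ => (ltac:(by rewrite lee_fin powR_ge0))).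
have H2 : ((\int[mu]_(x in E i) (x `^ (e - 1))%:E)%E @[i --> \oo] --> (a `^ e / e)%:E).
  have -> : (fun i => (\int[mu]_(x in E i) (x `^ (e - 1))%:E)%E) =
      (fun i => ((a `^ e - (a / i.+2%:R) `^ e) / e)%:E).
    apply/funext => i; rewrite /E integral_powR_itvcc ?gt_eqF ?divr_gt0//.
    by rewrite ltr_pdivrMr// ltr_pMr// ltr1n.
  apply: cvg_EFin; first by apply: nearW.
  rewrite [X in _ --> X](_ : _ = (a `^ e - 0) / e); last by rewrite subr0.
  apply: cvgMl; apply: cvgB; first exact: cvg_cst.
  have /cvg_at_rightP := @powR_cvg0 R e e0; apply; split=> [i|].
    by rewrite divr_gt0.
  rewrite -[X in _ --> X](mulr0 a); apply: cvgMr.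
  have := @cvg_harmonic R; rewrite -(cvg_shiftn 1)/=.
  by under eq_fun do rewrite addn1.
exact: (cvg_unique _ H H2).
Qed.

(** On each bounded interval from a to b the value is (b^e - a^e) / e, and b^e / e is nonpositive
    because e < 0; the bound passes to the limit along an exhaustion. *)
Lemma integral_powR_itvcy_le (e a : R) : e < 0 -> 0 < a ->
  (\int[mu]_(s in `[a, +oo[) (s `^ (e - 1))%:E <= (a `^ e / - e)%:E)%E.
Proof.
move=> e0 a0.
pose E (i : nat) : set (measurableTypeR R) := `[a, a + i.+1%:R]%classic.
have -> : `[a, +oo[%classic = \bigcup_i E i.
  apply/seteqP; split => x /=; rewrite in_itv/=.
    rewrite andbT => ax; exists (Num.truncn (x - a)) => //.
    rewrite /E/= in_itv/= ax -lerBlDl ltW// truncnS_gt// subr_ge0//.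
  by move=> [i _]; rewrite /E/= in_itv/= => /andP[->].
have ndE : nondecreasing_seq E.
  move=> i j ij; rewrite subsetEset => x; rewrite /E/= !in_itv/= => /andP[-> /=].
  by move/le_trans; apply; rewrite lerD2l ler_nat ltnS.
have H := @ge0_nondecreasing_set_cvg_integral _ _ _ E
  (fun s : measurableTypeR R => ((s : R) `^ (e - 1))%:E) mu ndE (fun i => measurable_itv _)
  (fun i => @measurable_powR_EFin _ _)
  (fun i x _ => (ltac:(by rewrite lee_fin powR_ge0))).
rewrite -(cvg_lim _ H)//; apply: lime_le; first by apply/cvg_ex; eexists; exact: H.
apply: nearW => i; rewrite /E integral_powR_itvcc ?lt_eqF ?ltrDl//.
rewrite lee_fin (_ : a `^ e / - e = (- a `^ e) / e); last by rewrite invrN mulrN mulNr.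
rewrite ler_nM2r ?invr_lt0//.
by rewrite lerDr powR_ge0.
Qed.

End power_integrals.

(* The value +oo at 0 makes the domination of [Vker] by a product of [rieszK]
   hold pointwise, also where a single coordinate vanishes. *)
Definition rieszK (R : realType) (g s : R) : \bar R :=
  if s == 0 then +oo%E else (`|s| `^ (g - 1))%:E.

(** * The one-dimensional Riesz kernel and its near and far parts *)

Section riesz_kernel.
Local Open Scope ereal_scope.
Context (R : realType) (g : R).
Local Notation mu := (@lebesgue_measure R).
Local Notation K := (rieszK g).

Lemma rieszK_gt0 s : 0 < K s.
Proof.
rewrite /rieszK; case: ifPn => // s0.
by rewrite lte_fin powR_gt0// normr_gt0.
Qed.

Lemma rieszK_ge0 s : 0 <= K s.
Proof. exact: ltW (rieszK_gt0 s). Qed.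

Lemma measurable_rieszK : measurable_fun [set: R] K.
Proof.
apply: measurable_fun_ifT => //; first exact: measurable_fun_eqr.
apply/measurable_EFinP; apply: (measurableT_comp (measurable_powR _)).
exact: normr_measurable.
Qed.

Lemma rieszKN s : K (- s)%R = K s.
Proof. by rewrite /rieszK oppr_eq0 normrN. Qed.

Lemma even_integral_le (h : R -> \bar R) : measurable_fun [set: R] h ->
  (forall x, 0 <= h x) -> (forall x, h (- x)%R = h x) ->
  \int[mu]_x h x <= 2%:E * \int[mu]_(x in `]0%R, +oo[) h x.
Proof.
move=> mh h0 hN.
have mD (D : set R) : measurable_fun D h by exact: measurable_funTS.
have -> : \int[mu]_x h x = \int[mu]_(x in `]-oo, 0%R] `|` `]0%R, +oo[) h x.
  congr integral; apply/seteqP; split => x //= _.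
  by case: (leP x 0%R) => x0; [left|right]; rewrite in_itv/= ?x0.
rewrite ge0_integral_setU//=; last 2 first.
- exact: mD.
- rewrite disj_set2E; apply/eqP/seteqP; split => x //= [].
  by rewrite !in_itv/= andbT => x0 /(le_lt_trans x0); rewrite ltxx.
have -> : \int[mu]_(x in `]-oo, 0%R]) h x = \int[mu]_(x in `[0%R, +oo[) h x.
  rewrite ge0_integration_by_substitution0//.
  by apply: eq_integral => x _; rewrite hN.
rewrite -integral_itv_obnd_cbnd//.
have : 0 <= \int[mu]_(x in `]0%R, +oo[) h x by exact: integral_ge0.
by move: (integral _ _ _) => [r| |] //= r0; rewrite -?EFinD -?EFinM ?lee_fin ?mulr2n ?mulrDl ?mul1r// mulry gtr0_sg// mul1e.
Qed.

Definition nearK (r s : R) := if (`|s| < r)%R then K s else 0.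
Definition farK (r s : R) := if (`|s| < r)%R then 0 else K s.

Lemma nearK_ge0 r s : 0 <= nearK r s.
Proof. by rewrite /nearK; case: ifP => // _; exact: rieszK_ge0. Qed.

Lemma farK_ge0 r s : 0 <= farK r s.
Proof. by rewrite /farK; case: ifP => // _; exact: rieszK_ge0. Qed.

Lemma rieszK_near_far r s : K s = nearK r s + farK r s.
Proof. by rewrite /nearK /farK; case: ifP; rewrite ?adde0 ?add0e. Qed.

Lemma measurable_nearK r : measurable_fun [set: R] (nearK r).
Proof.
apply: measurable_fun_ifT => //; last exact: measurable_rieszK.
by apply: measurable_fun_ltr => //; exact: normr_measurable.
Qed.

Lemma measurable_farK r : measurable_fun [set: R] (farK r).
Proof.
apply: measurable_fun_ifT => //; last exact: measurable_rieszK.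
by apply: measurable_fun_ltr => //; exact: normr_measurable.
Qed.

Lemma integral_nearK (r : R) : (0 < g)%R -> (0 < r)%R ->
  \int[mu]_s nearK r s <= (2 * (r `^ g / g))%:E.
Proof.
move=> g0 r0; apply: le_trans (even_integral_le _ _ _) _.
- exact: measurable_nearK.
- exact: nearK_ge0.
- by move=> x; rewrite /nearK normrN rieszKN.
rewrite EFinM lee_pmul2l// -(integral_powR_itv0c g0 r0).
rewrite integral_mkcond [leRHS]integral_mkcond.
apply: ge0_le_integralT => s; first by apply: erestrict_ge0 => x _; exact: nearK_ge0.
rewrite /patch !mem_setE !in_itv/= andbT; case: (ltP 0%R s) => //= s0.
rewrite /nearK /rieszK gt_eqF// gtr0_norm//.
by case: ltP => [/ltW ->//|_]; case: ifP => // _; rewrite lee_fin powR_ge0.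
Qed.

(** The power [(e - 1) / (g - 1)] turns |s|^(g-1) into |s|^(e-1), which is integrable at infinity.
    The parameter e is later chosen so that this power is the conjugate exponent of p. *)
Lemma integral_farK (r e : R) : (e < 0)%R -> (0 < r)%R -> (g < 1)%R ->
  \int[mu]_s (farK r s `^ ((e - 1) / (g - 1))) <= (2 * (r `^ e / - e))%:E.
Proof.
move=> e0 r0 g1.
have a0 : (0 < (e - 1) / (g - 1))%R.
  by rewrite ltr_ndivlMr ?subr_lt0// mul0r subr_lt0 (lt_trans e0).
apply: le_trans (even_integral_le _ _ _) _.
- by apply: measurable_fun_poweR; exact: measurable_farK.
- by move=> x; exact: poweR_ge0.
- by move=> x; rewrite /farK normrN rieszKN.
rewrite EFinM lee_pmul2l//; apply: le_trans (integral_powR_itvcy_le e0 r0).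
rewrite integral_mkcond [leRHS]integral_mkcond.
apply: ge0_le_integralT => s; first by apply: erestrict_ge0 => x _; exact: poweR_ge0.
rewrite /patch !mem_setE !in_itv/= !andbT; case: (ltP 0%R s) => s0; last first.
  by case: ifP => // _; rewrite lee_fin powR_ge0.
rewrite /farK gtr0_norm//; have [sr|rs] := ltP (s : R) r.
  by rewrite poweR0r ?gt_eqF// leNgt sr.
rewrite /rieszK gt_eqF// gtr0_norm// poweR_EFin -powRrM mulrC divfK//.
by rewrite lt_eqF// subr_lt0.
Qed.

End riesz_kernel.

(** * The one-dimensional Hardy-Littlewood-Sobolev inequality *)

Section hls1.
Local Open Scope ereal_scope.
Context (R : realType) (p q : R).
Local Notation mu := (@lebesgue_measure R).
Hypotheses (p1 : (1 < p)%R) (pq : (p < q)%R).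
Let g := (p^-1 - q^-1)%R.
Local Notation K := (rieszK g).
Let p0 : (0 < p)%R. Proof. exact: lt_trans p1. Qed.
Let q0 : (0 < q)%R. Proof. exact: lt_trans pq. Qed.
Let p10 : (0 < p - 1)%R. Proof. by rewrite subr_gt0. Qed.
Let g0 : (0 < g)%R. Proof. by rewrite subr_gt0 ltf_pV2. Qed.
Let g1 : (g < 1)%R.
Proof.
have : (p^-1 < 1)%R by rewrite invf_lt1.
have : (0 < q^-1)%R by rewrite invr_gt0.
rewrite /g; lra.
Qed.
Let p' := (p / (p - 1))%R.
Let p'0 : (0 < p')%R. Proof. by rewrite divr_gt0. Qed.
(** This value solves (g - 1) p' = e - 1, see [ep'], so that [integral_farK] computes the L^p' norm
    of the far kernel. That norm is then at most b r^(-1/q), with [b] the constant defined next. *)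
Let e := (- (p' / q))%R.
Let e0 : (e < 0)%R. Proof. by rewrite oppr_lt0 divr_gt0. Qed.
Let b := ((2 / - e) `^ p'^-1)%R.
Let b0 : (0 < b)%R. Proof. by rewrite powR_gt0// divr_gt0// oppr_gt0. Qed.
Let ep' : ((e - 1) / (g - 1) = p')%R.
Proof.
have gn : (g - 1 != 0)%R by rewrite lt_eqF// subr_lt0.
apply: (mulIf gn); rewrite divfK// /e /g /p'; field.
by rewrite !gt_eqF.
Qed.

(** The constant is tuned so that, for the radius r attached to level s, the height [h s] times the
    bound 2 r^g / g on the near kernel's integral is exactly s/4; the exponent in [h] comes from q/p
    = 1 + q g. *)
Let d := (g / (8 * (2 * b) `^ (q * g)))%R.
Let d0 : (0 < d)%R.
Proof. by rewrite divr_gt0// mulr_gt0// powR_gt0// mulr_gt0. Qed.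
Let h (s : R) := (d * s `^ (q / p))%R.
Let h0 s : (0 < s)%R -> (0 < h s)%R.
Proof. by move=> s0; rewrite mulr_gt0// powR_gt0. Qed.

Section normalized.
Variable f : R -> \bar R.
Hypotheses (mf : measurable_fun [set: R] f) (f0 : forall x, 0 <= f x).
Hypothesis f1 : \int[mu]_x (f x `^ p) <= 1.

Let mKxy (k : R -> \bar R) x : measurable_fun [set: R] k ->
  measurable_fun [set: R] (fun y => k (x - y)%R).
Proof. by move=> mk; apply: measurableT_comp => //; exact: measurable_funB. Qed.

(** Hölder with exponents p' and p, where the normalization makes the norm of f at most 1. The
    exponent is e / p' = -1/q. *)
Let far_bound (x r : R) : (0 < r)%R ->
  \int[mu]_y (farK g r (x - y) * f y) <= (b * r `^ (- q^-1))%:E.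
Proof.
move=> r0.
have mk : measurable_fun [set: R] (farK g r) by exact: measurable_farK.
have pp' : (p'^-1 + p^-1 = 1)%R.
  by rewrite /p' invf_div mulrBl mul1r divff ?gt_eqF// subrK.
apply: le_trans (hoelder_lebesgue (mKxy x mk) mf _ f0 p'0 p0 pp') _.
  by move=> y; exact: farK_ge0.
rewrite -[leRHS]mule1; apply: lee_pmul; rewrite ?poweR_ge0//; last first.
  rewrite -[leRHS](poweR1r p^-1); apply: le_poweR => //.
    by rewrite invr_ge0 ltW.
  by apply: integral_ge0 => y _; exact: poweR_ge0.
rewrite (integral_reflect x (f := fun y => farK g r y `^ p')); last 2 first.
- exact: measurable_fun_poweR.
- by move=> y; exact: poweR_ge0.
have H := @integral_farK R g r e e0 r0 g1; rewrite ep' in H.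
apply: le_trans (le_poweR _ _ H) _.
- by rewrite invr_ge0 ltW.
- by apply: integral_ge0 => y _; exact: poweR_ge0.
rewrite poweR_EFin lee_fin mulrCA mulrC powRM ?powR_ge0//; last first.
  by rewrite divr_ge0// oppr_ge0 ltW.
rewrite -/b -powRrM (_ : e / p' = - q^-1)%R// /e mulNr mulrAC divff ?mul1r//.
by rewrite gt_eqF.
Qed.

Let T x := \int[mu]_y (K (x - y)%R * f y).

Let T0 x : 0 <= T x.
Proof. by apply: integral_ge0 => y _; rewrite mule_ge0 ?rieszK_ge0. Qed.

Let mK2 (k : R -> \bar R) (f' : R -> \bar R) :
  measurable_fun [set: R] k -> measurable_fun [set: R] f' ->
  measurable_fun [set: R * R]
    (fun z => k (z.1 - z.2)%R * f' z.2).
Proof.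
move=> mk mf'; apply: emeasurable_funM; last exact: measurableT_comp.
by apply: measurableT_comp => //; exact: measurable_funB.
Qed.

Let mT : measurable_fun [set: R] T.
Proof.
apply: measurable_fun_integral; last exact: mK2 (measurable_rieszK g) mf.
by move=> *; rewrite mule_ge0 ?rieszK_ge0.
Qed.

Let ind (A : bool) : \bar R := if A then 1 else 0.

(** Where T exceeds s, the far part accounts for at most s/2 and the near part acting on [f2] for at
    most s/4, so [W], the near part acting on [f1'], is at least s/4. Chebyshev's inequality for
    [W], whose integral is at most c times that of [f1'], gives the claim because [h s] equals s /
    (4c). *)
Let weak_type (s : R) : (0 < s)%R ->
  (h s)%:E * \int[mu]_x ind (s%:E < T x) <=
  \int[mu]_y (if (h s)%:E < f y then f y else 0).
Proof.
move=> s0.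
(* This radius solves b r^(-1/q) = s/2, which makes [far_bound] yield s/2. *)
pose r := ((2 * b / s) `^ q)%R.
have bs0 : (0 < 2 * b / s)%R by rewrite divr_gt0// mulr_gt0.
have r0 : (0 < r)%R by rewrite powR_gt0.
pose c := (2 * (r `^ g / g))%R.
have c0 : (0 < c)%R by rewrite mulr_gt0// divr_gt0// powR_gt0.
have hE : (h s = s / 4 / c)%R.
  have e1 : (q / p = 1 + q * g)%R.
    by rewrite /g mulrBr divff ?gt_eqF// addrC subrK.
  have e2 : (r `^ g = (2 * b) `^ (q * g) / s `^ (q * g))%R.
    rewrite /r -powRrM powRM ?mulr_ge0 ?invr_ge0 ?(ltW b0) ?(ltW s0)//.
    by congr (_ * _)%R; rewrite -powR_inv1 ?(ltW s0)// -powRrM mulN1r powRN.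
  rewrite /h e1 powRD; last by rewrite (gt_eqF s0) implybT.
  rewrite powRr1 ?(ltW s0)// /d /c e2; field.
  by rewrite !gt_eqF// ?powR_gt0// ?mulr_gt0.
have brs : (b * r `^ (- q^-1) = s / 2)%R.
  rewrite /r -powRrM mulrN divff ?gt_eqF// powR_inv1 ?(ltW bs0)//.
  by field; rewrite !gt_eqF.
pose f1' y := if (h s)%:E < f y then f y else 0.
pose f2 y := if (h s)%:E < f y then 0 else f y.
have mlt : measurable_fun [set: R] (fun y => (h s)%:E < f y).
  by apply: measurable_fun_lte.
have mf1 : measurable_fun [set: R] f1' by exact: measurable_fun_ifT.
have mf2 : measurable_fun [set: R] f2 by exact: measurable_fun_ifT.
have f10 y : 0 <= f1' y by rewrite /f1'; case: ifP.
have f20 y : 0 <= f2 y by rewrite /f2; case: ifP.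
have f2h y : f2 y <= (h s)%:E.
  by rewrite /f2; case: ltP => // _; rewrite lee_fin ltW// h0.
have f12 y : f y = f1' y + f2 y by rewrite /f1' /f2; case: ifP; rewrite ?adde0 ?add0e.
have mN : measurable_fun [set: R] (nearK g r) by exact: measurable_nearK.
have mF : measurable_fun [set: R] (farK g r) by exact: measurable_farK.
pose W x := \int[mu]_y (nearK g r (x - y) * f1' y).
have W0 x : 0 <= W x by apply: integral_ge0 => y _; rewrite mule_ge0 ?nearK_ge0.
have pt x : (s / 4)%:E * ind (s%:E < T x) <= W x.
  rewrite /ind; case: ifPn => [sT|_]; last by rewrite mule0.
  rewrite mule1.
  have TE : T x = W x + \int[mu]_y (nearK g r (x - y) * f2 y) +
      \int[mu]_y (farK g r (x - y) * f y).
    have mm (k f' : R -> \bar R) : measurable_fun [set: R] k -> measurable_fun [set: R] f' ->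
        measurable_fun [set: R] (fun y => k (x - y)%R * f' y).
      by move=> mk mf'; apply: emeasurable_funM => //; exact: mKxy.
    rewrite -ge0_integralD//; last 4 first.
    - by move=> y _; rewrite mule_ge0 ?nearK_ge0.
    - exact: mm.
    - by move=> y _; rewrite mule_ge0 ?nearK_ge0.
    - exact: mm.
    rewrite -ge0_integralD//; last 4 first.
    - by move=> y _; rewrite adde_ge0// mule_ge0 ?nearK_ge0.
    - by apply: emeasurable_funD; exact: mm.
    - by move=> y _; rewrite mule_ge0 ?farK_ge0.
    - exact: mm.
    apply: eq_integral => y _.
    rewrite -ge0_muleDr// -f12 -ge0_muleDl ?nearK_ge0 ?farK_ge0//.
    by rewrite -rieszK_near_far.
  have I2 : \int[mu]_y (nearK g r (x - y) * f2 y) <= (s / 4)%:E.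
    apply: (@le_trans _ _ (\int[mu]_y ((h s)%:E * nearK g r (x - y)))).
      apply: ge0_le_integralT => y; first by rewrite mule_ge0 ?nearK_ge0.
      by rewrite muleC lee_wpmul2r ?nearK_ge0.
    rewrite ge0_integralZl//; last 3 first.
    - exact: mKxy.
    - by move=> y _; exact: nearK_ge0.
    - by rewrite lee_fin ltW// h0.
    rewrite (integral_reflect x mN); last by move=> y; exact: nearK_ge0.
    apply: (@le_trans _ _ ((h s)%:E * c%:E)).
      by apply: lee_wpmul2l; [rewrite lee_fin ltW// h0|exact: integral_nearK].
    by rewrite -EFinM hE divfK// gt_eqF.
  have I3 := far_bound x r0; rewrite brs in I3.
  move: sT; rewrite TE; move: I2 I3 (W0 x).
  have : 0 <= \int[mu]_y (nearK g r (x - y) * f2 y).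
    by apply: integral_ge0 => y _; rewrite mule_ge0 ?nearK_ge0.
  have : 0 <= \int[mu]_y (farK g r (x - y) * f y).
    by apply: integral_ge0 => y _; rewrite mule_ge0 ?farK_ge0.
  move: (\int[mu]_y (nearK g r (x - y) * f2 y)) (\int[mu]_y (farK g r (x - y) * f y)) (W x).
  move=> [i2| |] [i3| |] [w| |] //=; rewrite ?leey// -?EFinD !lee_fin lte_fin.
  lra.
have WI : \int[mu]_x W x <= c%:E * \int[mu]_y f1' y.
  rewrite /W integral_swap; last 2 first.
  - by move=> *; rewrite mule_ge0 ?nearK_ge0.
  - exact: (mK2 mN mf1).
  rewrite -ge0_integralZl//; last by rewrite lee_fin ltW.
  apply: ge0_le_integralT => y.
    by apply: integral_ge0 => x _; rewrite mule_ge0 ?nearK_ge0.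
  rewrite ge0_integralZr//; last 2 first.
  - by apply: measurableT_comp => //; exact: measurable_funB.
  - by move=> x _; exact: nearK_ge0.
  apply: lee_wpmul2r => //.
  rewrite (integral_shift (- y)%R mN); last by move=> x; exact: nearK_ge0.
  exact: integral_nearK.
have mind : measurable_fun [set: R] (fun x => ind (s%:E < T x)).
  by apply: measurable_fun_ifT => //; exact: measurable_fun_lte.
have ind0 x : 0 <= ind (s%:E < T x) by rewrite /ind; case: ifP.
have H : (s / 4)%:E * \int[mu]_x ind (s%:E < T x) <= c%:E * \int[mu]_y f1' y.
  rewrite -ge0_integralZl//; last by rewrite lee_fin divr_ge0// ltW.
  apply: le_trans WI; apply: ge0_le_integralT => //.
  by move=> x; rewrite mule_ge0// lee_fin divr_ge0// ltW.
apply: (@le_trans _ _ (\int[mu]_y f1' y)) => //.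
have -> : (h s)%:E = c^-1%:E * (s / 4)%:E by rewrite -EFinM hE mulrC.
have -> : \int[mu]_y f1' y = c^-1%:E * (c%:E * \int[mu]_y f1' y).
  by rewrite muleA -EFinM mulVf ?gt_eqF// mul1e.
rewrite -muleA.
by apply: lee_wpmul2l => //; rewrite lee_fin invr_ge0 ltW.
Qed.

(** The derivative of s^q, extended by zero so that the level s may run over the whole line when
    integrals are swapped. Its quotient [psi] by [h] is the weight left after [weak_type] is applied
    at each level. *)
Let phi (s : R) : R := if (0 < s)%R then (q * s `^ (q - 1))%R else 0%R.
Let psi (s : R) : R := if (0 < s)%R then (q * s `^ (q - 1) / h s)%R else 0%R.

Let phi_ge0 s : (0 <= phi s)%R.
Proof. by rewrite /phi; case: ifP => // _; rewrite mulr_ge0 ?powR_ge0// ltW. Qed.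

Let psi_ge0 s : (0 <= psi s)%R.
Proof.
rewrite /psi; case: ifP => // s0.
by rewrite divr_ge0//; [rewrite mulr_ge0 ?powR_ge0// ltW|rewrite ltW// h0].
Qed.

Let mphi : measurable_fun [set: R] phi.
Proof.
apply: measurable_fun_ifT => //; first exact: measurable_fun_ltr.
by apply: measurable_funM => //; exact: measurable_powR.
Qed.

Let mh : measurable_fun [set: R] h.
Proof. by apply: measurable_funM => //; exact: measurable_powR. Qed.

Let psiE s : psi s = (phi s * (if (0 < s)%R then d^-1 * s `^ (- (q / p)) else 0))%R.
Proof.
rewrite /psi /phi; case: ifP => s0; last by rewrite mul0r.
by rewrite /h invfM powRN.
Qed.

Let mpsi : measurable_fun [set: R] psi.
Proof.
rewrite (_ : psi = fun s => phi s * (if (0 < s)%R then d^-1 * s `^ (- (q / p)) else 0))%R; last exact/funext/psiE.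
apply: measurable_funM => //; apply: measurable_fun_ifT => //; first exact: measurable_fun_ltr.
by apply: measurable_funM => //; exact: measurable_powR.
Qed.

Let layer_cake_fin (a : R) : (0 <= a)%R ->
  (a `^ q)%:E <= \int[mu]_s ((phi s)%:E * ind (s%:E < a%:E)).
Proof.
rewrite le_eqVlt => /predU1P[<-|a0].
  rewrite powR0 ?gt_eqF//; apply: integral_ge0 => s _.
  by rewrite mule_ge0 ?lee_fin// /ind; case: ifP.
have -> : (a `^ q)%:E = \int[mu]_(s in `]0%R, a[) (q%:E * (s `^ (q - 1))%:E).
  rewrite ge0_integralZl//; last 3 first.
  - exact: measurable_powR_EFin.
  - by move=> s _; rewrite lee_fin powR_ge0.
  - by rewrite lee_fin ltW.
  rewrite integral_itv_bndo_bndc; last exact: measurable_powR_EFin.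
  by rewrite integral_powR_itv0c// -EFinM mulrC divfK ?gt_eqF.
rewrite integral_mkcond; apply: ge0_le_integralT => s.
  by apply: erestrict_ge0 => x _; rewrite -EFinM lee_fin mulr_ge0 ?powR_ge0// ltW.
rewrite /patch mem_setE in_itv/= /phi /ind lte_fin.
by case: (ltP 0%R s) => /= s0; case: (ltP s a) => _; rewrite ?mule1 ?mule0 ?mul0e// EFinM.
Qed.

(** For infinite [a] the right-hand side exceeds every positive real t, by the finite case at
    t^(1/q). *)
Let layer_cake (a : \bar R) : 0 <= a ->
  a `^ q <= \int[mu]_s ((phi s)%:E * ind (s%:E < a)).
Proof.
case: a => [a| |]//; first by rewrite lee_fin => /layer_cake_fin.
move=> _; rewrite poweRyr ?gt_eqF// leye_eq; apply/eqP/eqyP => t t0.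
have : (0 <= t `^ q^-1)%R by exact: powR_ge0.
move=> /layer_cake_fin; rewrite -powRrM mulVf ?gt_eqF// powRr1 ?(ltW t0)//.
move=> /le_trans; apply; apply: ge0_le_integralT => s.
  by rewrite mule_ge0 ?lee_fin// /ind; case: ifP.
apply: lee_wpmul2l; first by rewrite lee_fin.
by rewrite /ind ltry; case: ifP.
Qed.

Let C := (q / (d `^ p * (q - q / p)))%R.
Let C0 : (0 < C)%R.
Proof.
rewrite divr_gt0// mulr_gt0// ?powR_gt0// subr_gt0 ltr_pdivrMr//.
by rewrite ltr_pMr.
Qed.

(** For real a > 0 the condition h s < a confines s to ]0, A], where the integrand is a multiple of
    s^(q - q/p - 1). This is integrable at 0 because p > 1, and the resulting power of a is exactly
    p, with constant [C]. *)
Let inner_bound (a : \bar R) : 0 <= a ->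
  \int[mu]_s ((psi s)%:E * (if (h s)%:E < a then a else 0)) <= C%:E * a `^ p.
Proof.
case: a => [a| |]//; last first.
  by move=> _; rewrite poweRyr ?gt_eqF// gt0_muley ?leey ?lte_fin.
rewrite lee_fin le_eqVlt => /predU1P[<-|a0].
  rewrite integral0_eq; first by rewrite mule_ge0 ?poweR_ge0 ?lee_fin ?ltW.
  by move=> s _; case: ifP; rewrite mule0.
have e'0 : (0 < q - q / p)%R.
  by rewrite subr_gt0 ltr_pdivrMr// ltr_pMr.
(* The level at which [h] takes the value [a]. *)
pose A := ((a / d) `^ (p / q))%R.
have ad : (0 < a / d)%R by rewrite divr_gt0.
have A0 : (0 < A)%R by rewrite powR_gt0.
have aqd : (0 <= a * q / d)%R by rewrite ltW// divr_gt0// mulr_gt0.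
apply: (@le_trans _ _ (\int[mu]_(s in `]0%R, A]) ((a * q / d)%:E * (s `^ (q - q / p - 1))%:E))).
  rewrite [leRHS]integral_mkcond; apply: ge0_le_integralT => s.
    by rewrite mule_ge0 ?lee_fin//; case: ifP => // _; rewrite lee_fin ltW.
  rewrite lte_fin /patch mem_setE in_itv/= /psi.
  case: (ltP 0%R s) => /= s0; last by rewrite mul0e.
  case: ifPn => [hsa|_]; last first.
    rewrite mule0; case: ifP => // _.
    by apply: mule_ge0; rewrite lee_fin ?powR_ge0.
  have sA : (s <= A)%R.
    have s1 : (s `^ (q / p) <= a / d)%R by rewrite ler_pdivlMr// mulrC ltW.
    have /(_ (ltac:(by rewrite ltW// divr_gt0))) := @ge0_ler_powR R (p / q) _ _ _ _ _ s1.
    rewrite !nnegrE powR_ge0 (ltW ad) => /(_ isT isT).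
    rewrite -powRrM (_ : q / p * (p / q) = 1)%R ?powRr1 ?(ltW s0)//.
    by field; rewrite !gt_eqF.
  rewrite sA -!EFinM lee_fin /h.
  have -> : (q - q / p - 1 = (q - 1) - q / p)%R by rewrite addrAC.
  rewrite powRB; last by rewrite (gt_eqF s0) implybT.
  rewrite le_eqVlt; apply/orP; left; apply/eqP; field.
  by rewrite !gt_eqF// powR_gt0.
rewrite ge0_integralZl//; last 2 first.
- exact: measurable_powR_EFin.
- by move=> s _; rewrite lee_fin powR_ge0.
rewrite integral_powR_itv0c// poweR_EFin -!EFinM lee_fin.
rewrite /A -powRrM (_ : p / q * (q - q / p) = p - 1)%R; last by field; rewrite !gt_eqF.
rewrite powRB; last by rewrite (gt_eqF ad) implybT.
rewrite powRr1 ?(ltW ad)// powRM ?(ltW a0) ?invr_ge0 ?(ltW d0)//.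
have -> : (d^-1 `^ p = (d `^ p)^-1)%R.
  by rewrite -powR_inv1 ?(ltW d0)// -powRrM mulN1r powRN.
rewrite /C; move: e'0; set D := (q - q / p)%R => D0.
rewrite le_eqVlt; apply/orP; left; apply/eqP; field.
by rewrite !gt_eqF ?powR_gt0.
Qed.

Let mf2 : measurable_fun [set: R * R] (fun z => f z.2).
Proof. exact: measurableT_comp. Qed.

(** Layer cake in x, Tonelli, the weak-type bound at each level s, Tonelli again to bring the
    integral over s inside, and finally [inner_bound] at each y. *)
Lemma hls1_normalized : \int[mu]_x (T x `^ q) <= C%:E * \int[mu]_y (f y `^ p).
Proof.
have i0 x s : 0 <= (phi s)%:E * ind (s%:E < T x).
  by rewrite mule_ge0 ?lee_fin// /ind; case: ifP.
have mi1 : measurable_fun [set: R * R] (fun z => (phi z.2)%:E * ind (z.2%:E < T z.1)).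
  apply: emeasurable_funM.
    by apply/measurable_EFinP; exact: measurableT_comp.
  apply: measurable_fun_ifT => //; apply: measurable_fun_lte.
    exact/measurable_EFinP.
  exact: measurableT_comp.
have mi2 : measurable_fun [set: R * R]
    (fun z => (psi z.1)%:E * (if (h z.1)%:E < f z.2 then f z.2 else 0)).
  apply: emeasurable_funM.
    by apply/measurable_EFinP; exact: measurableT_comp.
  apply: measurable_fun_ifT => //; apply: measurable_fun_lte => //.
  by apply/measurable_EFinP; exact: measurableT_comp.
have j0 s y : 0 <= (psi s)%:E * (if (h s)%:E < f y then f y else 0).
  by rewrite mule_ge0 ?lee_fin//; case: ifP.
apply: (@le_trans _ _ (\int[mu]_x \int[mu]_s ((phi s)%:E * ind (s%:E < T x)))).
  apply: ge0_le_integralT => x; [exact: poweR_ge0|exact: layer_cake].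
rewrite integral_swap//.
apply: (@le_trans _ _ (\int[mu]_s \int[mu]_y
    ((psi s)%:E * (if (h s)%:E < f y then f y else 0)))).
  apply: ge0_le_integralT => s; first by apply: integral_ge0.
  have mind : measurable_fun [set: R] (fun x => ind (s%:E < T x)).
    by apply: measurable_fun_ifT => //; exact: measurable_fun_lte.
  rewrite ge0_integralZl//; last 2 first.
  - by move=> x _; rewrite /ind; case: ifP.
  - by rewrite lee_fin.
  rewrite ge0_integralZl//; last 3 first.
  - by apply: measurable_fun_ifT => //; exact: measurable_fun_lte.
  - by move=> x _; case: ifP.
  - by rewrite lee_fin.
  have [s0|s0] := ltP 0%R s; last by rewrite /phi /psi ltNge s0/= !mul0e.
  have -> : phi s = (psi s * h s)%R.
    by rewrite /psi /phi s0 divfK// gt_eqF// h0.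
  rewrite EFinM -muleA; apply: lee_wpmul2l; first by rewrite lee_fin.
  exact: weak_type.
rewrite integral_swap// -ge0_integralZl//; last 3 first.
- exact: measurable_fun_poweR.
- by move=> y _; exact: poweR_ge0.
- by rewrite lee_fin ltW.
apply: ge0_le_integralT => y; first by apply: integral_ge0.
exact: inner_bound.
Qed.

End normalized.

Lemma hls1 : exists2 B : R, (0 < B)%R & forall f : R -> \bar R,
  measurable_fun [set: R] f -> (forall x, 0 <= f x) ->
  (\int[mu]_x (\int[mu]_y (rieszK (p^-1 - q^-1) (x - y)%R * f y)) `^ q) `^ q^-1 <=
  B%:E * (\int[mu]_y (f y `^ p)) `^ p^-1.
Proof.
pose C := (q / (d `^ p * (q - q / p)))%R.
have C0 : (0 < C)%R.
  rewrite divr_gt0// mulr_gt0// ?powR_gt0// subr_gt0 ltr_pdivrMr//.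
  by rewrite ltr_pMr.
exists (C `^ q^-1)%R => [|f mf f0]; first by rewrite powR_gt0.
have CP : 0 < (C `^ q^-1)%:E by rewrite lte_fin powR_gt0.
have A0 : 0 <= \int[mu]_y (f y `^ p) by apply: integral_ge0 => y _; exact: poweR_ge0.
have [Ay|Ay] := eqVneq (\int[mu]_y (f y `^ p)) +oo.
  by rewrite Ay poweRyr ?gt_eqF ?invr_gt0// gt0_muley ?leey.
have Tge0 x : 0 <= \int[mu]_y (K (x - y)%R * f y).
  by apply: integral_ge0 => y _; rewrite mule_ge0 ?rieszK_ge0.
have ITge0 : 0 <= \int[mu]_x (\int[mu]_y (K (x - y)%R * f y)) `^ q.
  by apply: integral_ge0 => y _; exact: poweR_ge0.
have mfx x : measurable_fun [set: R] (fun y => K (x - y)%R * f y).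
  apply: emeasurable_funM => //.
  apply: measurableT_comp; [exact: measurable_rieszK|exact: measurable_funB].
have mT : measurable_fun [set: R] (fun x => \int[mu]_y (K (x - y)%R * f y)).
  apply: measurable_fun_integral; first by move=> *; rewrite mule_ge0 ?rieszK_ge0.
  apply: emeasurable_funM; last exact: measurableT_comp.
  by apply: measurableT_comp; [exact: measurable_rieszK|exact: measurable_funB].
(* A function of norm zero cannot be rescaled to norm 1, but the normalized bound already applies to
   it and gives 0. *)
have [Az|Az] := eqVneq (\int[mu]_y (f y `^ p)) 0.
  have := hls1_normalized mf f0; rewrite -/g Az mule0 poweR0r ?mule0; last first.
    by rewrite gt_eqF// invr_gt0.
  move=> /(_ (ltac:(by []))) H.
  have -> : \int[mu]_x (\int[mu]_y (K (x - y)%R * f y)) `^ q = 0.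
    by apply/eqP; rewrite eq_le H.
  by rewrite poweR0r// gt_eqF// invr_gt0.
have [a Aa] : exists a : R, \int[mu]_y (f y `^ p) = a%:E.
  by exists (fine (\int[mu]_y (f y `^ p))); rewrite fineK// ge0_fin_numE// ltey.
have a0 : (0 < a)%R by rewrite -lte_fin -Aa lt0e Az.
(* The reciprocal of the L^p norm of f; both sides of the inequality are homogeneous of degree 1 in
   f. *)
pose l := (a `^ (- p^-1))%R.
have l0 : (0 < l)%R by rewrite powR_gt0.
have lp : (l `^ p = a^-1)%R.
  by rewrite /l -powRrM mulNr mulVf ?gt_eqF// powR_inv1// ltW.
pose f' y := l%:E * f y.
have mf' : measurable_fun [set: R] f' by exact: measurable_funeM.
have f'0 y : 0 <= f' y by rewrite mule_ge0// lee_fin ltW.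
have If' : \int[mu]_y (f' y `^ p) = 1.
  under eq_integral do rewrite /f' poweRM// ?lee_fin ?(ltW l0)//.
  rewrite ge0_integralZl//; last 3 first.
  - exact: measurable_fun_poweR.
  - by move=> y _; exact: poweR_ge0.
  - exact: poweR_ge0.
  by rewrite Aa poweR_EFin -EFinM lp mulVf ?gt_eqF.
have := hls1_normalized mf' f'0; rewrite If' mule1 => /(_ (lexx _)).
have -> : \int[mu]_x (\int[mu]_y (K (x - y)%R * f' y)) `^ q =
    (l `^ q)%:E * \int[mu]_x (\int[mu]_y (K (x - y)%R * f y)) `^ q.
  rewrite -ge0_integralZl//; last 3 first.
  - exact: measurable_fun_poweR.
  - by move=> y _; exact: poweR_ge0.
  - by rewrite lee_fin powR_ge0.
  apply: eq_integral => x _.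
  have -> : \int[mu]_y (K (x - y)%R * f' y) = l%:E * \int[mu]_y (K (x - y)%R * f y).
    rewrite -ge0_integralZl//; last 3 first.
    - exact: mfx.
    - by move=> y _; rewrite mule_ge0 ?rieszK_ge0.
    - by rewrite lee_fin ltW.
    by apply: eq_integral => y _; rewrite muleCA.
  by rewrite poweRM// lee_fin ltW.
rewrite -/C => H.
have lq : (0 < l `^ q)%R by rewrite powR_gt0.
have {}H : \int[mu]_x (\int[mu]_y (K (x - y)%R * f y)) `^ q <= (C / l `^ q)%:E.
  by rewrite [leRHS]EFinM [leRHS]muleC lee_pdivlMl.
apply: le_trans (le_poweR _ _ H) _ => //; first by rewrite invr_ge0 ltW.
rewrite Aa !poweR_EFin -EFinM lee_fin powRM ?invr_ge0 ?(ltW lq) ?(ltW C0)//.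
rewrite ler_pM2l ?powR_gt0// -powR_inv1 ?(ltW lq)// -!powRrM.
rewrite (_ : - p^-1 * (q * (-1 / q)) = p^-1)%R//.
by field; rewrite !gt_eqF.
Qed.

End hls1.

(** * Iterated integrals over tuples and mixed-norm Minkowski inequalities *)

Section iterated_integral.
Local Open Scope ereal_scope.
Context (R : realType).
Local Notation mu := (@lebesgue_measure R).

Lemma iint_ge0 n (F : n.-tuple R -> \bar R) :
  (forall w, 0 <= F w) -> 0 <= iint F.
Proof.
by elim: n F => [|n IH] F F0 //=; apply: integral_ge0 => x _; exact: IH.
Qed.

Lemma le_iint n (F G : n.-tuple R -> \bar R) :
  (forall w, 0 <= F w) -> (forall w, F w <= G w) -> iint F <= iint G.
Proof.
elim: n F G => [|n IH] F G F0 FG //=.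
by apply: ge0_le_integralT => x; [exact: iint_ge0|exact: IH].
Qed.

Lemma abse_iint_le n (F : n.-tuple R -> \bar R) :
  `|iint F| <= iint (fun w => `|F w|).
Proof.
elim: n F => [|n IH] F //=.
by apply: le_trans (abse_integral_leT _ _) _; apply: ge0_le_integralT => // x.
Qed.

(** The parameter space is arbitrary so that the induction on n can absorb the head coordinate into
    it, passing from T to T * R. *)
Lemma measurable_fun_iint d (T : measurableType d) n (F : T -> n.-tuple R -> \bar R) :
  (forall z w, 0 <= F z w) ->
  measurable_fun [set: T * n.-tuple R] (fun z => F z.1 z.2) ->
  measurable_fun [set: T] (fun z => iint (F z)).
Proof.
elim: n d T F => [|n IH] d T F F0 mF /=.
  apply: (measurableT_comp mF (_ : measurable_fun _ (fun z : T => (z, [tuple])))).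
  exact: measurable_fun_pair.
apply: measurable_fun_integral => [z y|]; first exact: iint_ge0.
apply: (IH _ _ (fun (z : T * R) w => F z.1 (cons_tuple z.2 w))) => //.
apply: (measurableT_comp mF (_ : measurable_fun _
  (fun z : T * R * n.-tuple R => (z.1.1, cons_tuple z.1.2 z.2)))).
apply: measurable_fun_pair; first exact: measurableT_comp.
by apply: measurable_cons => //; exact: measurableT_comp.
Qed.

Lemma measurable_fun_cons_tuple n (F : n.+1.-tuple R -> \bar R) (x : R) :
  measurable_fun setT F -> measurable_fun setT (fun w => F (cons_tuple x w)).
Proof.
move=> mF; apply: (measurableT_comp mF (_ : measurable_fun _ (fun w => cons_tuple x w))).
exact: measurable_cons.
Qed.

Lemma iintZl n (k : \bar R) (F : n.-tuple R -> \bar R) : 0 <= k ->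
  (forall w, 0 <= F w) -> measurable_fun setT F ->
  iint (fun w => k * F w) = k * iint F.
Proof.
move=> k0; elim: n F => [|n IH] F F0 mF //=.
rewrite -ge0_integralZl//; last 2 first.
- apply: measurable_fun_iint => //.
  apply: (measurableT_comp mF (_ : measurable_fun _
    (fun z : R * n.-tuple R => cons_tuple z.1 z.2))).
  exact: measurable_cons.
- by move=> x _; exact: iint_ge0.
apply: eq_integral => x _; rewrite IH//; exact: measurable_fun_cons_tuple.
Qed.

Lemma poweRK (r : R) (x : \bar R) : (0 < r)%R -> 0 <= x -> (x `^ r) `^ r^-1 = x.
Proof. by move=> r0 x0; rewrite -poweRrM divff ?gt_eqF// poweRe1. Qed.

Lemma poweRVK (r : R) (x : \bar R) : (0 < r)%R -> 0 <= x -> (x `^ r^-1) `^ r = x.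
Proof. by move=> r0 x0; rewrite -poweRrM mulVf ?gt_eqF// poweRe1. Qed.

(** Induction on n: the one-variable inequality takes the norm inside the head integral, and the
    induction hypothesis, at a fixed head, takes it through the tail. *)
Lemma minkowski_integral_iint (q : R) n (F : R -> n.-tuple R -> \bar R) : (1 < q)%R ->
  (forall x w, 0 <= F x w) ->
  measurable_fun [set: R * n.-tuple R] (fun z => F z.1 z.2) ->
  (\int[mu]_x iint (F x) `^ q) `^ q^-1 <=
  iint (fun w => (\int[mu]_x (F x w `^ q)) `^ q^-1).
Proof.
move=> q1; elim: n F => [|n IH] F F0 mF //=.
have m3 : measurable_fun [set: R * R * n.-tuple R]
    (fun z => F z.1.1 (cons_tuple z.1.2 z.2)).
  apply: (measurableT_comp mF (_ : measurable_fun _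
    (fun z : R * R * n.-tuple R => (z.1.1, cons_tuple z.1.2 z.2)))).
  apply: measurable_fun_pair; first exact: measurableT_comp.
  by apply: measurable_cons => //; exact: measurableT_comp.
apply: le_trans (minkowski_lebesgue q1 _ _) _.
- by move=> x y; exact: iint_ge0.
- exact: (@measurable_fun_iint _ _ n (fun (z : R * R) w => F z.1 (cons_tuple z.2 w))).
apply: ge0_le_integralT => y; first exact: poweR_ge0.
apply: (IH (fun x w => F x (cons_tuple y w))) => //.
apply: (measurableT_comp mF (_ : measurable_fun _
    (fun z : R * n.-tuple R => (z.1, cons_tuple y z.2)))).
by apply: measurable_fun_pair => //; exact: measurable_cons.
Qed.

(** Induction on m: for a fixed head x the hypothesis handles the norm over the tail, and
    [minkowski_integral_iint] then handles the norm over x. Taking powers q and 1/q in turn glues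
    the two norms together. *)
Lemma minkowski_iint (q : R) m n (F : m.-tuple R -> n.-tuple R -> \bar R) : (1 < q)%R ->
  (forall x w, 0 <= F x w) ->
  measurable_fun [set: m.-tuple R * n.-tuple R] (fun z => F z.1 z.2) ->
  (iint (fun x => iint (F x) `^ q)) `^ q^-1 <=
  iint (fun w => (iint (fun x => F x w `^ q)) `^ q^-1).
Proof.
move=> q1; have q0 : (0 < q)%R by exact: lt_trans q1.
elim: m F => [|m IH] F F0 mF.
  rewrite /= poweRK ?iint_ge0//; apply: le_iint => // w.
  by rewrite poweRK.
have mF3 : measurable_fun [set: R * n.-tuple R * m.-tuple R]
   (fun z => F (cons_tuple z.1.1 z.2) z.1.2).
  apply: (measurableT_comp mF (_ : measurable_fun _
    (fun z : R * n.-tuple R * m.-tuple R => (cons_tuple z.1.1 z.2, z.1.2)))).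
  apply: measurable_fun_pair; last exact: measurableT_comp.
  by apply: measurable_cons => //; exact: measurableT_comp.
have mFx x : measurable_fun [set: m.-tuple R * n.-tuple R]
   (fun z => F (cons_tuple x z.1) z.2).
  apply: (measurableT_comp mF (_ : measurable_fun _
    (fun z : m.-tuple R * n.-tuple R => (cons_tuple x z.1, z.2)))).
  by apply: measurable_fun_pair => //; exact: measurable_cons.
apply: (@le_trans _ _ ((\int[mu]_x (iint (fun w =>
    (iint (fun x' => F (cons_tuple x x') w `^ q)) `^ q^-1)) `^ q) `^ q^-1)).
  apply: le_poweR; [by rewrite invr_ge0 ltW|by apply: iint_ge0 => w; exact: poweR_ge0|].
  apply: ge0_le_integralT => x /=; first by apply: iint_ge0 => w; exact: poweR_ge0.
  rewrite -[leLHS](poweRVK q0); last by apply: iint_ge0 => w; exact: poweR_ge0.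
  apply: le_poweR; [exact: ltW|exact: poweR_ge0|].
  exact: (IH (fun x' => F (cons_tuple x x'))).
apply: le_trans (minkowski_integral_iint q1 _ _) _.
- by move=> x w; exact: poweR_ge0.
- apply: measurable_fun_poweR.
  apply: (measurable_fun_iint (F := fun (z : R * n.-tuple R) x' => F (cons_tuple z.1 x') z.2 `^ q)).
    by move=> *; exact: poweR_ge0.
  exact: measurable_fun_poweR.
apply: le_iint => w; first exact: poweR_ge0.
rewrite /=; apply: le_poweR; [by rewrite invr_ge0 ltW| |].
  by apply: integral_ge0 => x _; exact: poweR_ge0.
apply: ge0_le_integralT => x; first exact: poweR_ge0.
by rewrite poweRVK//; apply: iint_ge0 => x'; exact: poweR_ge0.
Qed.

Lemma minkowski_iint_integral (q : R) m (F : m.-tuple R -> R -> \bar R) : (1 < q)%R ->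
  (forall x w, 0 <= F x w) ->
  measurable_fun [set: m.-tuple R * R] (fun z => F z.1 z.2) ->
  (iint (fun x => (\int[mu]_y F x y) `^ q)) `^ q^-1 <=
  \int[mu]_y (iint (fun x => F x y `^ q)) `^ q^-1.
Proof.
move=> q1 F0 mF.
(* A real variable is viewed as a 1-tuple, over which [iint] unfolds to a single integral. *)
apply: (minkowski_iint (F := fun x (w : 1.-tuple R) => F x (thead w))) => //.
apply: (measurableT_comp mF (_ : measurable_fun _
    (fun z : m.-tuple R * 1.-tuple R => (z.1, thead z.2)))).
apply: measurable_fun_pair => //.
by apply: (measurableT_comp (measurable_tnth ord0)).
Qed.

Lemma poweR_iintZl (q : R) n (k : \bar R) (F : n.-tuple R -> \bar R) : (0 < q)%R ->
  0 <= k -> (forall w, 0 <= F w) -> measurable_fun setT F ->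
  (iint (fun w => (k * F w) `^ q)) `^ q^-1 = k * (iint (fun w => F w `^ q)) `^ q^-1.
Proof.
move=> q0 k0 F0 mF.
rewrite (_ : (fun w => (k * F w) `^ q) = (fun w => k `^ q * F w `^ q)); last first.
  by apply/funext => w; rewrite poweRM.
rewrite iintZl ?poweR_ge0//; last 2 first.
- by move=> w; exact: poweR_ge0.
- exact: measurable_fun_poweR.
rewrite poweRM ?poweR_ge0 ?poweRK//; apply: iint_ge0 => w; exact: poweR_ge0.
Qed.

Lemma poweR_integralZl (q : R) (k : \bar R) (F : R -> \bar R) : (0 < q)%R ->
  0 <= k -> (forall w, 0 <= F w) -> measurable_fun setT F ->
  (\int[mu]_x (k * F x) `^ q) `^ q^-1 = k * (\int[mu]_x (F x `^ q)) `^ q^-1.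
Proof.
move=> q0 k0 F0 mF.
apply: (@poweR_iintZl q 1 k (fun w => F (thead w))) => //.
exact: (measurableT_comp mF (measurable_tnth ord0)).
Qed.

End iterated_integral.

(** A tensor-product kernel, used as a majorant of the radial one: its product form lets each
    coordinate be treated by the one-dimensional inequality. *)
Definition rieszKn (R : realType) (g : R) n (u w : n.-tuple R) : \bar R :=
  (\prod_(i < n) rieszK g (tnth u i - tnth w i)%R)%E.

(** * Hardy-Littlewood-Sobolev for the product kernel *)

Section hls_n.
Local Open Scope ereal_scope.
Context (R : realType).
Local Notation mu := (@lebesgue_measure R).

Lemma rieszKn_ge0 g n (u w : n.-tuple R) : 0 <= rieszKn g u w.
Proof.
rewrite /rieszKn; elim/big_ind : _ => //; first by move=> x y; exact: mule_ge0.
by move=> i _; exact: rieszK_ge0.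
Qed.

Lemma rieszKn_cons g n x y (u w : n.-tuple R) :
  rieszKn g (cons_tuple x u) (cons_tuple y w) = rieszK g (x - y) * rieszKn g u w.
Proof.
rewrite /rieszKn big_ord_recl !tnth0; congr (_ * _).
by apply: eq_bigr => i _; rewrite !tnthS.
Qed.

Lemma measurable_fun_rieszKn d (T : measurableType d) g n (u w : T -> n.-tuple R) :
  measurable_fun setT u -> measurable_fun setT w ->
  measurable_fun setT (fun z => rieszKn g (u z) (w z)).
Proof.
move=> /measurable_fun_tnthP mu /measurable_fun_tnthP mw; rewrite /rieszKn.
elim: (index_enum 'I_n) => [|i s IH].
  by rewrite (_ : (fun _ => _) = cst 1)//; apply/funext => z; rewrite big_nil.
rewrite (_ : (fun _ => _) = fun z => rieszK g (tnth (u z) i - tnth (w z) i)%R *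
    \prod_(j <- s) rieszK g (tnth (u z) j - tnth (w z) j)%R); last first.
  by apply/funext => z; rewrite big_cons.
apply: emeasurable_funM => //; apply: (measurableT_comp (measurable_rieszK g)).
by apply: measurable_funB; [exact: mu|exact: mw].
Qed.

Lemma rieszKn_row_measurable g n (u : n.-tuple R) :
  measurable_fun setT (fun w => rieszKn g u w).
Proof. exact: measurable_fun_rieszKn. Qed.

Section fixed_constant.
Variables (p q B : R).
Hypotheses (p1 : (1 < p)%R) (pq : (p < q)%R) (B0 : (0 < B)%R).
Let g := (p^-1 - q^-1)%R.
Hypothesis HB : forall f : R -> \bar R,
  measurable_fun [set: R] f -> (forall x, 0 <= f x) ->
  (\int[mu]_x (\int[mu]_y (rieszK g (x - y)%R * f y)) `^ q) `^ q^-1 <=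
  B%:E * (\int[mu]_y (f y `^ p)) `^ p^-1.
Let p0 : (0 < p)%R. Proof. exact: lt_trans p1. Qed.
Let q1 : (1 < q)%R. Proof. exact: lt_trans pq. Qed.
Let q0 : (0 < q)%R. Proof. exact: lt_trans q1. Qed.

(** Induction on n. For a fixed head x, Minkowski moves the L^q norm over the tail inside the
    integral over the head y, and the induction hypothesis bounds the norm of [h y] by B^n [G y].
    What remains is the one-dimensional inequality for B^n [G], which supplies one more factor B. *)
Lemma hls_iint n (f : n.-tuple R -> \bar R) :
  measurable_fun setT f -> (forall x, 0 <= f x) ->
  (iint (fun u => (iint (fun w => rieszKn g u w * f w)) `^ q)) `^ q^-1 <=
  (B ^+ n)%:E * (iint (fun w => f w `^ p)) `^ p^-1.
Proof.
elim: n f => [|n IH] f mf f0.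
  by rewrite /= /rieszKn big_ord0 mul1e expr0 mul1e !poweRK.
have mfc : measurable_fun [set: R * n.-tuple R] (fun z => f (cons_tuple z.1 z.2)).
  apply: (measurableT_comp mf (_ : measurable_fun _
    (fun z : R * n.-tuple R => cons_tuple z.1 z.2))).
  exact: measurable_cons.
have mfx x : measurable_fun setT (fun w => f (cons_tuple x w)).
  exact: measurable_fun_cons_tuple.
pose h y u' := iint (fun w' => rieszKn g u' w' * f (cons_tuple y w')).
have h0 y u' : 0 <= h y u' by apply: iint_ge0 => w; rewrite mule_ge0 ?rieszKn_ge0.
have mh : measurable_fun [set: R * n.-tuple R] (fun z => h z.1 z.2).
  apply: measurable_fun_iint => [*|]; first by rewrite mule_ge0 ?rieszKn_ge0.
  apply: emeasurable_funM.
    by apply: measurable_fun_rieszKn => //; exact: measurableT_comp.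
  apply: (measurableT_comp mfc (_ : measurable_fun _
    (fun z : R * n.-tuple R * n.-tuple R => (z.1.1, z.2)))).
  by apply: measurable_fun_pair => //; exact: measurableT_comp.
have mhy y : measurable_fun setT (h y).
  apply: (measurableT_comp mh (_ : measurable_fun _
    (fun u : n.-tuple R => (y, u)))).
  exact: measurable_fun_pair.
pose G y := (iint (fun w' => f (cons_tuple y w') `^ p)) `^ p^-1.
have G0 y : 0 <= G y by exact: poweR_ge0.
have mG : measurable_fun setT G.
  apply: measurable_fun_poweR; apply: measurable_fun_iint; first by move=> *; exact: poweR_ge0.
  exact: measurable_fun_poweR.
have hE x y u' : iint (fun w' => rieszKn g (cons_tuple x u') (cons_tuple y w') * f (cons_tuple y w')) =
    rieszK g (x - y)%R * h y u'.
  rewrite -iintZl ?rieszK_ge0//; last 2 first.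
  - by move=> w; rewrite mule_ge0 ?rieszKn_ge0.
  - by apply: emeasurable_funM => //; exact: rieszKn_row_measurable.
  by congr iint; apply/funext => w; rewrite rieszKn_cons muleA.
have BG : (\int[mu]_x (\int[mu]_y (rieszK g (x - y)%R * ((B ^+ n)%:E * G y))) `^ q) `^ q^-1 <=
    (B ^+ n.+1)%:E * (iint (fun w => f w `^ p)) `^ p^-1.
  apply: le_trans (HB _ _) _.
  - exact: measurable_funeM.
  - by move=> x; rewrite mule_ge0// lee_fin exprn_ge0// ltW.
  rewrite poweR_integralZl// ?lee_fin ?exprn_ge0 ?(ltW B0)//.
  rewrite muleA -EFinM -exprS.
  rewrite le_eqVlt; apply/orP; left; apply/eqP; congr (_ * _ `^ _).
  rewrite /=; apply: eq_integral => y _; rewrite /G poweRVK//.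
  by apply: iint_ge0 => w; exact: poweR_ge0.
apply: le_trans BG.
apply: le_poweR; first by rewrite invr_ge0 ltW.
  by apply: iint_ge0 => u; exact: poweR_ge0.
rewrite /=; apply: ge0_le_integralT => x; first by apply: iint_ge0 => u; exact: poweR_ge0.
rewrite -[leLHS](poweRVK q0); last by apply: iint_ge0 => u; exact: poweR_ge0.
apply: le_poweR; [exact: ltW|exact: poweR_ge0|].
rewrite (_ : (fun u => _) = (fun u => (\int[mu]_y (rieszK g (x - y)%R * h y u)) `^ q)); last first.
  by apply/funext => u; congr (_ `^ _); apply: eq_integral => y _; exact: hE.
apply: le_trans (minkowski_iint_integral q1 _ _) _.
- by move=> u y; rewrite mule_ge0 ?rieszK_ge0.
- apply: emeasurable_funM.
    apply: (measurableT_comp (measurable_rieszK g)).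
    by apply: measurable_funB => //; exact: measurableT_comp.
  apply: (measurableT_comp mh (_ : measurable_fun _
    (fun z : n.-tuple R * R => (z.2, z.1)))).
  exact: measurable_fun_pair.
apply: ge0_le_integralT => y; first exact: poweR_ge0.
rewrite poweR_iintZl ?rieszK_ge0//.
apply: lee_wpmul2l; first exact: rieszK_ge0.
exact: (IH (fun w => f (cons_tuple y w))).
Qed.

End fixed_constant.

End hls_n.

(** * Domination of the kernel by a product of Riesz kernels *)

Section kernel_domination.
Context (R : realType).

Lemma le0_ler_powR (r x y : R) : r <= 0 -> 0 < x -> x <= y -> y `^ r <= x `^ r.
Proof.
move=> r0 x0 xy; rewrite -[r]opprK !(powRN _ (- r)) lef_pV2 ?posrE ?powR_gt0//.
  by apply: ge0_ler_powR; rewrite ?nnegrE ?oppr_ge0// ltW// (lt_le_trans x0).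
exact: lt_le_trans xy.
Qed.

(** Both c and its inverse are at most their sum, and the exponent is nonpositive; the sign of s
    decides which of the two to keep. The absolute value in [rho] thus permits either sign of alpha
    - n beta. *)
Lemma powR_addV_le (c s : R) : 0 < c -> (c + c^-1) `^ (- `|s|) <= c `^ (- s).
Proof.
move=> c0; have cV : 0 < c^-1 by rewrite invr_gt0.
have [s0|s0] := leP 0 s.
  by rewrite ger0_norm// le0_ler_powR ?oppr_le0// lerDl ltW.
rewrite ltr0_norm// opprK (@le_trans _ _ (c^-1 `^ s))//.
  by apply: le0_ler_powR => //; [exact: ltW|rewrite lerDr ltW].
by rewrite -[in leLHS]powR_inv1 ?(ltW c0)// -powRrM mulN1r.
Qed.

Lemma enorm_ge_coord n (a : n.-tuple R) i : `|tnth a i| <= enorm a.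
Proof.
rewrite /enorm -sqrtr_sqr; apply: ler_wsqrtr.
by rewrite (bigD1 i)//= lerDl sumr_ge0// => j _; exact: sqr_ge0.
Qed.

Lemma le_prode_exp n (c : R) (k : 'I_n -> \bar R) : 0 <= c ->
  (forall i, c%:E <= k i)%E -> ((c ^+ n)%:E <= \prod_(i < n) k i)%E.
Proof.
move=> c0; elim: n k => [|n IH] k ck; first by rewrite big_ord0 expr0.
rewrite big_ord_recl exprS EFinM; apply: lee_pmul => //.
- by rewrite lee_fin exprn_ge0.
- exact: IH.
Qed.

(** Each coordinate is at most the norm in absolute value and g - 1 is negative, so every factor on
    the right is at least the norm to the power g - 1. *)
Lemma enorm_powR_le n (g : R) (a : n.-tuple R) : g < 1 -> enorm a != 0 ->
  ((enorm a `^ (n%:R * (g - 1)))%:E <= \prod_(i < n) rieszK g (tnth a i))%E.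
Proof.
move=> g1 a0; have {}a0 : 0 < enorm a by rewrite lt0r a0 sqrtr_ge0.
rewrite mulrC powRrM powR_mulrn ?powR_ge0//.
apply: le_prode_exp; first exact: powR_ge0.
move=> i; rewrite /rieszK; case: ifPn => [_|ai]; first exact: leey.
by rewrite lee_fin le0_ler_powR ?normr_gt0 ?enorm_ge_coord// subr_le0 ltW.
Qed.

(** With P = |a||b| and t = |s|, the bracket is at most (P/t)^(-sg) for the signed exponent [sg]
    whose absolute value is [rho]. This shift turns the exponents of P and t into n (g - 1) and g -
    1. *)
Lemma Vker_le n (alpha beta : R) (a b : n.-tuple R) (s : R) :
  let g := (alpha + beta) / (n%:R + 1) in g < 1 ->
  ((Vker alpha beta (a, b, s))%:E <= \prod_(i < n) rieszK g (tnth a i) *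
    (\prod_(i < n) rieszK g (tnth b i) * rieszK g s))%E.
Proof.
move=> g g1.
have p0 (w : n.-tuple R) : (0 <= \prod_(i < n) rieszK g (tnth w i))%E.
  elim/big_ind : _ => //; first by move=> x y; exact: mule_ge0.
  by move=> i _; exact: rieszK_ge0.
rewrite /Vker; case: ifPn => [/andP[/andP[an bn] sn]|_]; last first.
  by rewrite !mule_ge0 ?rieszK_ge0.
apply: (@le_trans _ _ ((enorm a `^ (n%:R * (g - 1)))%:E *
   ((enorm b `^ (n%:R * (g - 1)))%:E * (`|s| `^ (g - 1))%:E))%E); last first.
  apply: lee_pmul; rewrite ?lee_fin ?mulr_ge0 ?powR_ge0//.
    exact: enorm_powR_le.
  apply: lee_pmul; rewrite ?lee_fin ?powR_ge0//; first exact: enorm_powR_le.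
  by rewrite /rieszK (negbTE sn).
have a0 : 0 < enorm a by rewrite lt0r an sqrtr_ge0.
have b0 : 0 < enorm b by rewrite lt0r bn sqrtr_ge0.
have s0 : 0 < `|s| by rewrite normr_gt0.
rewrite -!EFinM lee_fin mulrA -!powRM ?(ltW a0) ?(ltW b0)//.
move: (enorm a * enorm b) (mulr_gt0 a0 b0) => P P0.
move: `|s| s0 => t t0.
pose sg := (alpha - n%:R * beta) / (n%:R + 1).
have n1 : 0 < n%:R + 1 :> R by rewrite ltr_wpDl.
have -> : rho n alpha beta = `|sg|.
  by rewrite /rho /sg normrM (gtr0_norm (x := _^-1))// invr_gt0.
rewrite -[t / P]invf_div.
have Pt : 0 < P / t by rewrite divr_gt0.
apply: le_trans (ler_wpM2l _ (powR_addV_le sg Pt)) _.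
  by rewrite mulr_ge0 ?powR_ge0.
rewrite powRM ?(ltW P0) ?invr_ge0 ?(ltW t0)//.
have -> : t^-1 `^ (- sg) = t `^ sg.
  by rewrite -powR_inv1 ?(ltW t0)// -powRrM mulrNN mul1r.
rewrite mulrACA -!powRD; try by rewrite ?(gt_eqF P0) ?(gt_eqF t0) implybT.
rewrite (_ : alpha - n%:R - sg = n%:R * (g - 1)); last first.
  by rewrite /sg /g; field; rewrite gt_eqF.
rewrite (_ : beta - 1 + sg = g - 1)//.
by rewrite /sg /g; field; rewrite gt_eqF.
Qed.

End kernel_domination.

(** * Sufficiency: the twisted product kernel, one variable at a time *)

Section sufficiency.
Local Open Scope ereal_scope.
Context (R : realType).
Local Notation mu := (@lebesgue_measure R).
Variables (n : nat) (m p q B : R).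
Hypotheses (p1 : (1 < p)%R) (pq : (p < q)%R) (B0 : (0 < B)%R).
Let g := (p^-1 - q^-1)%R.
Hypothesis HB : forall f : R -> \bar R,
  measurable_fun [set: R] f -> (forall x, 0 <= f x) ->
  (\int[mu]_x (\int[mu]_y (rieszK g (x - y)%R * f y)) `^ q) `^ q^-1 <=
  B%:E * (\int[mu]_y (f y `^ p)) `^ p^-1.
Let p0 : (0 < p)%R. Proof. exact: lt_trans p1. Qed.
Let q1 : (1 < q)%R. Proof. exact: lt_trans pq. Qed.
Let q0 : (0 < q)%R. Proof. exact: lt_trans q1. Qed.

Local Notation vec := (n.-tuple R).

(** The non-commutative term in the last coordinate of the product with an inverse; it involves
    neither t nor tau. *)
Definition twist (u v xi eta : vec) : R := (m * (edot u (topp eta) - edot v (topp xi)))%R.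

Lemma measurable_edot_topp d (T : measurableType d) (u : vec) (w : T -> vec) :
  measurable_fun setT w -> measurable_fun setT (fun z => edot u (topp (w z))).
Proof.
move=> /measurable_fun_tnthP mw; rewrite /edot.
apply: measurable_sum => i; apply: measurable_funM => //.
rewrite (_ : (fun _ => _) = fun z => - tnth (w z) i)%R; last first.
  by apply/funext => z; rewrite tnth_mktuple.
by apply: measurable_funN; exact: mw.
Qed.

Lemma measurable_twist d (T : measurableType d) (u v : vec) (xi eta : T -> vec) :
  measurable_fun setT xi -> measurable_fun setT eta ->
  measurable_fun setT (fun z => twist u v (xi z) (eta z)).
Proof.
move=> mxi meta; apply: measurable_funM => //.
by apply: measurable_funB; exact: measurable_edot_topp.
Qed.

Variable F : vec -> vec -> R -> \bar R.
Hypothesis F0 : forall xi eta t, 0 <= F xi eta t.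
Hypothesis mF : measurable_fun [set: vec * vec * R] (fun z => F z.1.1 z.1.2 z.2).

Let mF_comp d (T : measurableType d) (a b : T -> vec) (c : T -> R) :
  measurable_fun setT a -> measurable_fun setT b -> measurable_fun setT c ->
  measurable_fun setT (fun z => F (a z) (b z) (c z)).
Proof.
move=> ma mb mc.
apply: (measurableT_comp mF (_ : measurable_fun _ (fun z => (a z, b z, c z)))).
by apply: measurable_fun_pair => //; exact: measurable_fun_pair.
Qed.

(** The stages of the peeling: [J] integrates out tau, [Phi] adds the horizontal kernels, [G] bounds
    the L^q norm of [J] in t independently of u and v, and [H] applies the eta kernel to [G]. *)
Let J (u v : vec) t xi eta :=
  \int[mu]_tau (rieszK g (t + twist u v xi eta - tau)%R * F xi eta tau).

Let J0 u v t xi eta : 0 <= J u v t xi eta.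
Proof. by apply: integral_ge0 => tau _; rewrite mule_ge0 ?rieszK_ge0. Qed.

Let mJ d (T : measurableType d) u v (t : T -> R) (xi eta : T -> vec) :
  measurable_fun setT t -> measurable_fun setT xi -> measurable_fun setT eta ->
  measurable_fun setT (fun z => J u v (t z) (xi z) (eta z)).
Proof.
move=> mt mxi meta; apply: measurable_fun_integral => [*|].
  by rewrite mule_ge0 ?rieszK_ge0.
apply: emeasurable_funM.
  apply: (measurableT_comp (measurable_rieszK g)); apply: measurable_funB => //.
  apply: measurable_funD; first exact: measurableT_comp.
  by apply: measurable_twist; exact: measurableT_comp.
by apply: mF_comp => //; exact: measurableT_comp.
Qed.

Let Phi u v t xi eta := rieszKn g u xi * (rieszKn g v eta * J u v t xi eta).

Let Phi0 u v t xi eta : 0 <= Phi u v t xi eta.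
Proof. by rewrite !mule_ge0 ?rieszKn_ge0. Qed.

Let mPhi d (T : measurableType d) u v (t : T -> R) (xi eta : T -> vec) :
  measurable_fun setT t -> measurable_fun setT xi -> measurable_fun setT eta ->
  measurable_fun setT (fun z => Phi u v (t z) (xi z) (eta z)).
Proof.
move=> mt mxi meta; apply: emeasurable_funM; first exact: measurable_fun_rieszKn.
by apply: emeasurable_funM; [exact: measurable_fun_rieszKn|exact: mJ].
Qed.

Let G xi eta := B%:E * (\int[mu]_t (F xi eta t `^ p)) `^ p^-1.

Let G0 xi eta : 0 <= G xi eta.
Proof. by rewrite mule_ge0 ?poweR_ge0// lee_fin ltW. Qed.

Let mG d (T : measurableType d) (xi eta : T -> vec) :
  measurable_fun setT xi -> measurable_fun setT eta ->
  measurable_fun setT (fun z => G (xi z) (eta z)).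
Proof.
move=> mxi meta; apply: measurable_funeM; apply: measurable_fun_poweR.
apply: measurable_fun_integral => [*|]; first exact: poweR_ge0.
by apply: measurable_fun_poweR; apply: mF_comp => //; exact: measurableT_comp.
Qed.

Let H xi v := iint (fun eta => rieszKn g v eta * G xi eta).

Let H0 xi v : 0 <= H xi v.
Proof. by apply: iint_ge0 => eta; rewrite mule_ge0 ?rieszKn_ge0. Qed.

Let mH d (T : measurableType d) (xi v : T -> vec) :
  measurable_fun setT xi -> measurable_fun setT v ->
  measurable_fun setT (fun z => H (xi z) (v z)).
Proof.
move=> mxi mv; apply: measurable_fun_iint => [*|].
  by rewrite mule_ge0 ?rieszKn_ge0.
apply: emeasurable_funM.
  by apply: measurable_fun_rieszKn => //; exact: measurableT_comp.
by apply: mG => //; exact: measurableT_comp.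
Qed.

(** As a function of t, [J] is a translate by the twist of an untwisted potential, and the L^q norm
    in t ignores translations. *)
Let J_bound u v xi eta : (\int[mu]_t (J u v t xi eta `^ q)) `^ q^-1 <= G xi eta.
Proof.
have mFt : measurable_fun [set: R] (F xi eta) by exact: mF_comp.
pose T0 t := \int[mu]_tau (rieszK g (t - tau)%R * F xi eta tau).
have T00 t : 0 <= T0 t by apply: integral_ge0 => tau _; rewrite mule_ge0 ?rieszK_ge0.
have mT0 : measurable_fun [set: R] T0.
  apply: measurable_fun_integral => [*|]; first by rewrite mule_ge0 ?rieszK_ge0.
  apply: emeasurable_funM; last exact: measurableT_comp.
  by apply: (measurableT_comp (measurable_rieszK g)); exact: measurable_funB.
have := integral_shift (twist u v xi eta) (measurable_fun_poweR q mT0)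
  (fun r => poweR_ge0 _ _).
by rewrite /J -/(T0 _) => ->; exact: HB.
Qed.

(** Minkowski in t passes through xi and then eta; the horizontal kernels do not depend on t and
    come out of the norm, leaving [J_bound]. *)
Let t_bound u v :
  (\int[mu]_t (iint (fun xi => iint (Phi u v t xi))) `^ q) `^ q^-1 <=
  iint (fun xi => rieszKn g u xi * H xi v).
Proof.
apply: le_trans (minkowski_integral_iint q1 _ _) _.
- by move=> t xi; apply: iint_ge0.
- apply: (measurable_fun_iint (F := fun z : R * vec => Phi u v z.1 z.2)) => //.
  by apply: mPhi => //; exact: measurableT_comp.
apply: le_iint => xi; first exact: poweR_ge0.
apply: le_trans (minkowski_integral_iint q1 _ _) _ => //.
  exact: mPhi.
rewrite /H -iintZl ?rieszKn_ge0//; last 2 first.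
- by move=> eta; rewrite mule_ge0 ?rieszKn_ge0.
- by apply: emeasurable_funM; [exact: measurable_fun_rieszKn|exact: mG].
apply: le_iint => eta; first exact: poweR_ge0.
rewrite /Phi poweR_integralZl ?rieszKn_ge0//; last 2 first.
- by move=> t; rewrite mule_ge0 ?rieszKn_ge0.
- by apply: emeasurable_funM => //; exact: mJ.
rewrite poweR_integralZl ?rieszKn_ge0//; last exact: mJ.
apply: lee_wpmul2l; first exact: rieszKn_ge0.
by apply: lee_wpmul2l; [exact: rieszKn_ge0|exact: J_bound].
Qed.

Let Bn0 : 0 <= (B ^+ n)%:E. Proof. by rewrite lee_fin exprn_ge0// ltW. Qed.

Let G1 xi := (iint (fun eta => G xi eta `^ p)) `^ p^-1.

(** Minkowski over v passes through xi, after which [hls_iint] acts in v at each fixed xi. *)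
Let v_bound u :
  (iint (fun v => (iint (fun xi => rieszKn g u xi * H xi v)) `^ q)) `^ q^-1 <=
  iint (fun xi => rieszKn g u xi * ((B ^+ n)%:E * G1 xi)).
Proof.
apply: le_trans (minkowski_iint q1 _ _) _.
- by move=> v xi; rewrite mule_ge0 ?rieszKn_ge0.
- by apply: emeasurable_funM; [exact: measurable_fun_rieszKn|exact: mH].
apply: le_iint => xi; first exact: poweR_ge0.
rewrite poweR_iintZl ?rieszKn_ge0//; last exact: mH.
apply: lee_wpmul2l; first exact: rieszKn_ge0.
exact: (hls_iint p1 pq B0 HB (mG _ _)).
Qed.

(** The norm is taken in t first, then in v, then in u. Since [G] no longer sees the twist, the last
    two stages are untwisted, and each of the 2n+1 variables contributes one factor B. *)
Lemma twisted_hls :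
  (iint (fun u => iint (fun v => \int[mu]_t
     (iint (fun xi => iint (fun eta => \int[mu]_tau
        (rieszKn g u xi * (rieszKn g v eta *
          (rieszK g (t + twist u v xi eta - tau)%R * F xi eta tau)))))) `^ q)))
    `^ q^-1 <=
  (B ^+ (n + n).+1)%:E *
  (iint (fun xi => iint (fun eta => \int[mu]_tau (F xi eta tau `^ p)))) `^ p^-1.
Proof.
have iqV : (0 <= q^-1)%R by rewrite invr_ge0 ltW.
have PhiE u v t xi eta : \int[mu]_tau
        (rieszKn g u xi * (rieszKn g v eta *
          (rieszK g (t + twist u v xi eta - tau)%R * F xi eta tau))) = Phi u v t xi eta.
  have mm : measurable_fun [set: R] (fun tau => rieszK g (t + twist u v xi eta - tau)%R * F xi eta tau).
    apply: emeasurable_funM; last exact: mF_comp.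
    by apply: (measurableT_comp (measurable_rieszK g)); exact: measurable_funB.
  rewrite ge0_integralZl ?rieszKn_ge0//; last 2 first.
  - exact: measurable_funeM.
  - by move=> tau _; rewrite !mule_ge0 ?rieszKn_ge0 ?rieszK_ge0.
  rewrite ge0_integralZl ?rieszKn_ge0//.
  by move=> tau _; rewrite !mule_ge0 ?rieszKn_ge0 ?rieszK_ge0.
have G10 xi : 0 <= G1 xi by exact: poweR_ge0.
have mG1 : measurable_fun setT G1.
  apply: measurable_fun_poweR; apply: measurable_fun_iint => [*|]; first exact: poweR_ge0.
  by apply: measurable_fun_poweR; exact: mG.
(* The last stage, in u: n more factors B arise here, and one was stored in [G]. The nested L^p
   norms over tau, eta and xi collapse into a single one. *)
have S1 : (iint (fun u => (iint (fun xi => rieszKn g u xi * ((B ^+ n)%:E * G1 xi))) `^ q)) `^ q^-1 <=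
  (B ^+ (n + n).+1)%:E *
  (iint (fun xi => iint (fun eta => \int[mu]_tau (F xi eta tau `^ p)))) `^ p^-1.
  apply: le_trans (hls_iint p1 pq B0 HB _ _) _.
  - exact: measurable_funeM.
  - by move=> xi; rewrite mule_ge0.
  rewrite poweR_iintZl// muleA -EFinM -exprD exprSr EFinM -[leRHS]muleA.
  apply: lee_wpmul2l; first by rewrite lee_fin exprn_ge0// ltW.
  have mF1 d (T : measurableType d) (xi eta : T -> vec) :
     measurable_fun setT xi -> measurable_fun setT eta ->
     measurable_fun setT (fun z => \int[mu]_tau (F (xi z) (eta z) tau `^ p)).
    move=> mxi meta; apply: measurable_fun_integral => [*|]; first exact: poweR_ge0.
    by apply: measurable_fun_poweR; apply: mF_comp => //; exact: measurableT_comp.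
  have Fp0 xi eta : 0 <= \int[mu]_tau (F xi eta tau `^ p).
    by apply: integral_ge0 => tau _; exact: poweR_ge0.
  have G1E xi : G1 xi = B%:E * (iint (fun eta => \int[mu]_tau (F xi eta tau `^ p))) `^ p^-1.
    rewrite /G1 /G poweR_iintZl//; last 3 first.
    - by rewrite lee_fin ltW.
    - by move=> eta; exact: poweR_ge0.
    - by apply: measurable_fun_poweR; exact: mF1.
    by congr (_ * _ `^ _); congr iint; apply/funext => eta; rewrite poweRVK.
  rewrite (_ : (fun xi => G1 xi `^ p) = fun xi =>
      (B%:E * (iint (fun eta => \int[mu]_tau (F xi eta tau `^ p))) `^ p^-1) `^ p); last first.
    by apply/funext => xi; rewrite G1E.
  rewrite poweR_iintZl//; last 3 first.
  - by rewrite lee_fin ltW.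
  - by move=> xi; exact: poweR_ge0.
  - apply: measurable_fun_poweR; apply: measurable_fun_iint => //; exact: mF1.
  rewrite (_ : (fun xi => (_ `^ p^-1) `^ p) =
      (fun xi => iint (fun eta => \int[mu]_tau (F xi eta tau `^ p))))//.
  by apply/funext => xi; rewrite poweRVK// iint_ge0.
apply: le_trans S1; apply: le_poweR => //.
  by apply: iint_ge0 => u; apply: iint_ge0 => v; apply: integral_ge0 => t _; exact: poweR_ge0.
apply: le_iint => u.
  by apply: iint_ge0 => v; apply: integral_ge0 => t _; exact: poweR_ge0.
apply: (@le_trans _ _ (iint (fun v => (iint (fun xi => rieszKn g u xi * H xi v)) `^ q))).
  apply: le_iint => v; first by apply: integral_ge0 => t _; exact: poweR_ge0.
  rewrite [leLHS](_ : _ = \int[mu]_t (iint (fun xi => iint (Phi u v t xi)) `^ q)); last first.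
    apply: eq_integral => t _; congr (_ `^ _); congr iint; apply/funext => xi.
    by congr iint; apply/funext => eta; exact: PhiE.
  rewrite -[leLHS](poweRVK q0); last by apply: integral_ge0 => t _; exact: poweR_ge0.
  by apply: le_poweR; [exact: ltW|exact: poweR_ge0|exact: t_bound].
rewrite -[leLHS](poweRVK q0); last by apply: iint_ge0 => v; exact: poweR_ge0.
by apply: le_poweR; [exact: ltW|exact: poweR_ge0|exact: v_bound].
Qed.

End sufficiency.

(** Absolute values are moved inside the three integrals in turn, so that |f| and the product
    majorant of the kernel replace f and the kernel; [twisted_hls] then concludes. *)
Lemma Iop_bounded (R : realType) (n : nat) (mu alpha beta p q : R) :
  1 < p -> p < q -> (alpha + beta) / (n%:R + 1) = p^-1 - q^-1 ->
  exists B : R, 0 < B /\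
     forall f : pt R n -> R, measurable_fun setT f ->
       (LnormP q (Iop mu alpha beta f) <= B%:E * LnormP p (EFin \o f))%E.
Proof.
move=> p1 pq gE.
have [B B0 HB] := hls1 p1 pq.
have q0 : 0 < q by rewrite (lt_trans _ pq)// (lt_trans _ p1).
have g1 : (alpha + beta) / (n%:R + 1) < 1.
  have : p^-1 < 1 by rewrite invf_lt1// (lt_trans _ p1).
  have : 0 < q^-1 by rewrite invr_gt0.
  by rewrite gE; lra.
exists (B ^+ (n + n).+1); split; first exact: exprn_gt0.
move=> f mf.
pose F (xi eta : n.-tuple R) (t : R) : \bar R := `|(f (xi, eta, t))%:E|%E.
have F0 xi eta t : (0 <= F xi eta t)%E by exact: abse_ge0.
have mF : measurable_fun [set: n.-tuple R * n.-tuple R * R] (fun z => F z.1.1 z.1.2 z.2).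
  rewrite (_ : (fun _ => _) = fun z => `|(f z)%:E|%E); last first.
    by apply/funext => -[[a b] c].
  by apply: measurableT_comp => //; exact/measurable_EFinP.
have := @twisted_hls R n mu p q B p1 pq B0 HB F F0 mF.
rewrite /LnormP /intP; apply: le_trans.
apply: le_poweR; first by rewrite invr_ge0 ltW.
  apply: iint_ge0 => u; apply: iint_ge0 => v; apply: integral_ge0 => t _.
  exact: poweR_ge0.
apply: le_iint => u.
  by apply: iint_ge0 => v; apply: integral_ge0 => t _; exact: poweR_ge0.
apply: le_iint => v; first by apply: integral_ge0 => t _; exact: poweR_ge0.
apply: ge0_le_integralT => t; first exact: poweR_ge0.
apply: le_poweR; [exact: ltW|exact: abse_ge0|].
rewrite /Iop /intP.
apply: le_trans (abse_iint_le _) _; apply: le_iint => xi; first exact: abse_ge0.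
apply: le_trans (abse_iint_le _) _; apply: le_iint => eta; first exact: abse_ge0.
apply: le_trans (abse_integral_leT _ _) _.
apply: ge0_le_integralT => tau; first exact: abse_ge0.
rewrite EFinM abseM -/(F xi eta tau) muleC !muleA.
apply: lee_wpmul2r => //.
rewrite gee0_abs; last first.
  rewrite lee_fin /Vker /=; case: ifP => // _.
  by rewrite !mulr_ge0 ?powR_ge0.
apply: le_trans (Vker_le _ _ _ g1) _.
rewrite -!muleA gE.
have prodE (a b : n.-tuple R) : (\prod_(i < n) rieszK (p^-1 - q^-1)
    (tnth (tadd a (topp b)) i) = rieszKn (p^-1 - q^-1) a b)%E.
  by apply: eq_bigr => i _; rewrite !tnth_mktuple.
by rewrite !prodE addrAC.
Qed.

(** * Boxes and their volumes *)

Section boxes.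
Local Open Scope ereal_scope.
Context (R : realType).
Local Notation mu := (@lebesgue_measure R).

Definition cell (a b x : R) : bool := (a <= x <= b)%R.

Definition box n (a b c d : R) (x : pt R n) : bool :=
  [&& all (cell a b) x.1.1, all (cell a b) x.1.2 & cell c d x.2].

Lemma integral_cell (a b k : R) : (a <= b)%R ->
  \int[mu]_x (if cell a b x then k%:E else 0) = ((b - a) * k)%:E.
Proof.
move=> ab.
transitivity (\int[mu]_(x in `[a, b]) (cst k%:E) x).
  rewrite [RHS]integral_mkcond; apply: eq_integral => x _.
  by rewrite /patch mem_setE in_itv.
rewrite integral_cst//= lebesgue_measure_itv/= lte_fin.
move: ab; rewrite le_eqVlt => /predU1P[->|ab].
  by rewrite ltxx mule0 subrr mul0r.
by rewrite ab -EFinB -EFinM mulrC.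
Qed.

Lemma iint_cst0 n : iint (fun _ : n.-tuple R => 0) = 0 :> \bar R.
Proof. by elim: n => //= n IH; rewrite integral0_eq. Qed.

Lemma iint_cell n (a b k : R) : (a <= b)%R ->
  iint (fun w : n.-tuple R => if all (cell a b) w then k%:E else 0) =
  ((b - a) ^+ n * k)%:E.
Proof.
move=> ab; elim: n => [|n IH] /=; first by rewrite expr0 mul1r.
rewrite exprS -mulrA -integral_cell//.
apply: eq_integral => x _; case: ifPn => [cx|ncx].
  by rewrite -IH; congr iint; apply/funext => w /=; rewrite ?cx.
by rewrite -[RHS](iint_cst0 n); congr iint; apply/funext => w /=; rewrite ?(negbTE ncx).
Qed.

(** Each inner integral is a constant times the indicator of the remaining factors, which is why the
    value k is carried along and the right-hand side is nested. *)
Lemma intP_box n (a b c d k : R) : (a <= b)%R -> (c <= d)%R ->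
  Defs.intP (fun x : pt R n => if box a b c d x then k%:E else 0) =
  ((b - a) ^+ n * ((b - a) ^+ n * ((d - c) * k)))%:E.
Proof.
move=> ab cd; rewrite /Defs.intP -(iint_cell n _ ab); congr iint; apply/funext => u.
rewrite -(iint_cell n _ ab).
have [cu|ncu] := boolP (all (cell a b) u).
  congr iint; apply/funext => v; rewrite -(integral_cell _ cd).
  case: ifPn => [cv|ncv].
    by apply: eq_integral => t _; rewrite /box/= cu cv.
  by apply: integral0_eq => t _; rewrite /box/= (negbTE ncv) andbF.
rewrite -[RHS](iint_cst0 n); congr iint; apply/funext => v.
by apply: integral0_eq => t _; rewrite /box/= (negbTE ncu).
Qed.

Lemma le_intP n (F G : pt R n -> \bar R) : (forall x, 0 <= F x) ->
  (forall x, F x <= G x) -> Defs.intP F <= Defs.intP G.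
Proof.
move=> F0 FG; apply: le_iint => u.
  by apply: iint_ge0 => v; apply: integral_ge0.
apply: le_iint => v; first by apply: integral_ge0.
exact: ge0_le_integralT.
Qed.

Lemma measurable_all_cell d (T : measurableType d) n (a b : R) (w : T -> n.-tuple R) :
  measurable_fun setT w -> measurable_fun setT (fun z => all (cell a b) (w z)).
Proof.
move=> /measurable_fun_tnthP mw.
rewrite (_ : (fun _ => _) = fun z => \big[andb/true]_(i < n) cell a b (tnth (w z) i)); last first.
  by apply/funext => z; rewrite -big_all big_tuple.
elim: (index_enum 'I_n) => [|i s IH].
  by rewrite (_ : (fun _ => _) = cst true)//; apply/funext => z; rewrite big_nil.
rewrite (_ : (fun _ => _) = fun z => cell a b (tnth (w z) i) &&
    \big[andb/true]_(j <- s) cell a b (tnth (w z) j)); last first.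
  by apply/funext => z; rewrite big_cons.
apply: measurable_and => //; apply: measurable_and.
  by apply: measurable_fun_ler => //; exact: mw.
by apply: measurable_fun_ler => //; exact: mw.
Qed.

Lemma measurable_box n (a b c d : R) : measurable_fun setT (@box n a b c d).
Proof.
apply: measurable_and.
  by apply: measurable_all_cell; exact: measurableT_comp.
apply: measurable_and.
  by apply: measurable_all_cell; exact: measurableT_comp.
by apply: measurable_and; exact: measurable_fun_ler.
Qed.

End boxes.

(** * Lower bound for the kernel at scale l *)

Section kernel_lower_bound.
Context (R : realType).

(** For e >= 0 the lower bound on x suffices, and for e < 0 the upper bound; the absolute value
    gives one constant for both signs. *)
Lemma powR_scale_ge (l L x e : R) : 0 < l -> 1 <= L -> l <= x -> x <= l * L ->
  l `^ e * L `^ (- `|e|) <= x `^ e.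
Proof.
move=> l0 L1 lx xL.
have x0 : 0 < x by exact: lt_le_trans lx.
have L0 : 0 < L by exact: lt_le_trans L1.
have [e0|e0] := leP 0 e.
  apply: (@le_trans _ _ (l `^ e)).
    rewrite ger_pMr ?powR_gt0// powRN invf_le1 ?powR_gt0//.
    have := @ge0_ler_powR R `|e| (normr_ge0 _) 1 L.
    by rewrite !nnegrE powR1 ler01 (ltW L0); apply.
  by apply: ge0_ler_powR; rewrite ?nnegrE// ltW.
rewrite ltr0_norm// opprK -powRM ?(ltW l0) ?(ltW L0)//.
by apply: le0_ler_powR => //; exact: ltW.
Qed.

Lemma enorm_cell n (l : R) (a : n.-tuple R) : (0 < n)%N -> 0 < l ->
  (forall i, l <= tnth a i <= 3 * l) -> l <= enorm a <= l * (3 * n%:R).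
Proof.
move=> n0 l0 al; apply/andP; split.
  have /andP[ai _] := al (Ordinal n0).
  by apply: le_trans (enorm_ge_coord _ (Ordinal n0)); apply: le_trans (ler_norm _).
have n1 : 1 <= n%:R :> R by rewrite ler1n.
have h0 : 0 <= l * (3 * n%:R) by rewrite !mulr_ge0// ltW.
rewrite -(ger0_norm h0) -sqrtr_sqr; apply: ler_wsqrtr.
apply: (@le_trans _ _ (\sum_(i < n) (3 * l) ^+ 2)).
  apply: ler_sum => i _; have /andP[a1 a2] := al i.
  by rewrite ler_sqr ?nnegrE//; [exact: le_trans (ltW l0) a1|rewrite mulr_ge0// ltW].
rewrite sumr_const card_ord -[_ *+ n]mulr_natr.
have -> : (l * (3 * n%:R)) ^+ 2 = (3 * l) ^+ 2 * (n%:R * n%:R) by ring.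
by rewrite ler_wpM2l ?sqr_ge0// ler_peMr.
Qed.

(** At this scale |a| and |b| are comparable to l and s to l^2, so the bracket is bounded
    independently of l, and the other factors contribute l^(2(alpha-n)) and l^(2(beta-1)). *)
Lemma Vker_ge n (alpha beta T : R) : (0 < n)%N -> 1 <= T ->
  exists2 c : R, 0 < c & forall (l : R) (a b : n.-tuple R) (s : R), 0 < l ->
    (forall i, l <= tnth a i <= 3 * l) -> (forall i, l <= tnth b i <= 3 * l) ->
    l * l <= s <= l * l * T ->
    c * l `^ (2 * (alpha + beta - n%:R - 1)) <= Vker alpha beta (a, b, s).
Proof.
move=> n0 T1; pose L := 3 * n%:R : R.
have n1 : 1 <= n%:R :> R by rewrite ler1n.
have L1 : 1 <= L by rewrite /L; lra.
have L0 : 0 < L by exact: lt_le_trans L1.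
have T0 : 0 < T by exact: lt_le_trans T1.
(* An upper bound for the bracket: |a||b|/s is at most L^2 and s/(|a||b|) at most T. *)
pose Q := L * L + T.
have Q0 : 0 < Q by rewrite addr_gt0// mulr_gt0.
have r0 : 0 <= rho n alpha beta by rewrite divr_ge0// addr_ge0.
exists (L `^ (- `|alpha - n%:R|) * L `^ (- `|alpha - n%:R|) * T `^ (- `|beta - 1|) *
   Q `^ (- rho n alpha beta)); first by rewrite !mulr_gt0 ?powR_gt0.
move=> l a b s l0 al bl /andP[s1 s2].
have /andP[a1 a2] := enorm_cell n0 l0 al.
have /andP[b1 b2] := enorm_cell n0 l0 bl.
have ll0 : 0 < l * l by rewrite mulr_gt0.
have s0 : 0 < s by exact: lt_le_trans s1.
have a0 : 0 < enorm a by exact: lt_le_trans a1.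
have b0 : 0 < enorm b by exact: lt_le_trans b1.
rewrite /Vker !gt_eqF//= (gtr0_norm s0).
move: (enorm a) (enorm b) a0 b0 a1 a2 b1 b2 => A B A0 B0 A1 A2 B1 B2.
have AB0 : 0 < A * B by rewrite mulr_gt0.
have HA := @powR_scale_ge l L A (alpha - n%:R) l0 L1 A1 A2.
have HB := @powR_scale_ge l L B (alpha - n%:R) l0 L1 B1 B2.
have HS := @powR_scale_ge (l * l) T s (beta - 1) ll0 T1 s1 s2.
have HQ : Q `^ (- rho n alpha beta) <= (A * B / s + s / (A * B)) `^ (- rho n alpha beta).
  apply: le0_ler_powR; first by rewrite oppr_le0.
    by rewrite addr_gt0// divr_gt0.
  apply: lerD.
    rewrite ler_pdivrMr// (@le_trans _ _ (l * L * (l * L)))//.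
      by rewrite ler_pM// ltW.
    have -> : l * L * (l * L) = L * L * (l * l) by ring.
    by rewrite ler_wpM2l// mulr_ge0// ltW.
  rewrite ler_pdivrMr// (le_trans s2)// mulrC ler_wpM2l ?(ltW T0)//.
  by rewrite ler_pM// ltW.
have pw0 x e : 0 <= x `^ e :> R by exact: powR_ge0.
apply: (@le_trans _ _ ((l `^ (alpha - n%:R) * L `^ (- `|alpha - n%:R|)) *
   (l `^ (alpha - n%:R) * L `^ (- `|alpha - n%:R|)) *
   ((l * l) `^ (beta - 1) * T `^ (- `|beta - 1|)) * Q `^ (- rho n alpha beta))).
  rewrite powRM ?(ltW l0)//.
  have -> : 2 * (alpha + beta - n%:R - 1) = (alpha - n%:R) + (alpha - n%:R) +
      ((beta - 1) + (beta - 1)) by ring.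
  have lD e1 e2 : l `^ (e1 + e2) = l `^ e1 * l `^ e2.
    by rewrite powRD// (gt_eqF l0) implybT.
  rewrite (lD (alpha - n%:R + (alpha - n%:R))) (lD (alpha - n%:R) (alpha - n%:R)).
  rewrite (lD (beta - 1) (beta - 1)).
  by rewrite le_eqVlt; apply/orP; left; apply/eqP; ring.
by do 3! [apply: ler_pM; rewrite ?mulr_ge0//].
Qed.

End kernel_lower_bound.

(** * Necessity: testing on boxes of every scale *)

Section necessity.
Context (R : realType).

Lemma norm_edot_topp_le n (u w : n.-tuple R) (a b : R) :
  (forall i, `|tnth u i| <= a) -> (forall i, `|tnth w i| <= b) ->
  `|edot u (topp w)| <= n%:R * (a * b).
Proof.
move=> ua wb; apply: le_trans (ler_norm_sum _ _ _) _.
apply: (@le_trans _ _ (\sum_(i < n) a * b)); last first.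
  by rewrite sumr_const card_ord mulr_natl.
apply: ler_sum => i _; rewrite tnth_mktuple normrM normrN.
by apply: ler_pM.
Qed.

Definition box_indic n (l : R) (y : pt R n) : R := if box 0 l 0 (l * l) y then 1 else 0.

(** For x in the shifted box and y in the support, the horizontal coordinates of x times the inverse
    of y lie between l and 3l, and the vertical one between l^2 and 2T l^2. [Vker_ge] then applies
    on a box of volume l^(2n+2), which restores the exponent 2(alpha+beta). *)
Lemma Iop_box_ge n (mu alpha beta : R) : (0 < n)%N ->
  exists T : R, exists2 c : R, 0 < c & forall l : R, 0 < l ->
    forall x : pt R n, box (2 * l) (3 * l) (l * l * T) (l * l * (T + 1)) x ->
    ((c * l `^ (2 * (alpha + beta)))%:E <=
     Iop mu alpha beta (box_indic l) x)%E.
Proof.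
(* The twist is at most M l^2: each of its two inner products is at most n times 3l times l. *)
move=> n0; pose M := `|mu| * (n%:R * 6).
have M0 : 0 <= M by rewrite mulr_ge0// mulr_ge0.
(* This height leaves at least l^2 in the last coordinate after tau (at most l^2) and the twist (at
   most M l^2) are subtracted. *)
pose T := 2 + M; exists T.
have T1 : 1 <= T + T by rewrite /T; lra.
have [c c0 Hc] := @Vker_ge R n alpha beta (T + T) n0 T1.
exists c => // l l0 [[u v] t] /and3P[/= /all_tnthP bu /all_tnthP bv /andP[t1 t2]].
have ll0 : 0 < l * l by rewrite mulr_gt0.
have lD e1 e2 : l `^ (e1 + e2) = l `^ e1 * l `^ e2.
  by rewrite powRD// (gt_eqF l0) implybT.
have -> : c * l `^ (2 * (alpha + beta)) = (l - 0) ^+ n * ((l - 0) ^+ n *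
    ((l * l - 0) * (c * l `^ (2 * (alpha + beta - n%:R - 1))))).
  rewrite !subr0 -!powR_mulrn ?(ltW l0)//.
  have -> : 2 * (alpha + beta) = n%:R + (n%:R + (1 + (1 + 2 * (alpha + beta - n%:R - 1)))) by ring.
  rewrite !(lD n%:R) !(lD 1) powRr1 ?(ltW l0)//; ring.
rewrite -intP_box ?(ltW l0) ?(ltW ll0)//.
rewrite /Iop; apply: le_intP => [y|[[xi eta] tau]].
  by case: ifP => // _; rewrite lee_fin mulr_ge0 ?powR_ge0// ltW.
rewrite /box_indic; case: ifPn => [|_]; last by rewrite mul0r.
move=> /and3P[/= /all_tnthP bxi /all_tnthP beta' /andP[tau1 tau2]]; rewrite mul1r lee_fin.
apply: Hc => // [i|i|].
- by rewrite !tnth_mktuple; have /andP[] := bu i; have /andP[] := bxi i; lra.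
- by rewrite !tnth_mktuple; have /andP[] := bv i; have /andP[] := beta' i; lra.
have nu (w : n.-tuple R) : (forall i, cell (2 * l) (3 * l) (tnth w i)) ->
    forall i, `|tnth w i| <= 3 * l.
  by move=> bw i; have /andP[w1 w2] := bw i; rewrite ger0_norm//; lra.
have nx (w : n.-tuple R) : (forall i, cell 0 l (tnth w i)) ->
    forall i, `|tnth w i| <= l.
  by move=> bw i; have /andP[w1 w2] := bw i; rewrite ger0_norm.
have E1 := norm_edot_topp_le (nu _ bu) (nx _ beta').
have E2 := norm_edot_topp_le (nu _ bv) (nx _ bxi).
have : `|mu * (edot u (topp eta) - edot v (topp xi))| <= M * (l * l).
  rewrite normrM /M -mulrA ler_wpM2l//.
  apply: le_trans (ler_normB _ _) _; apply: le_trans (lerD E1 E2) _.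
  by rewrite le_eqVlt; apply/orP; left; apply/eqP; ring.
rewrite ler_norml => /andP[w1 w2].
move: (mu * _) w1 w2 t1 t2 tau1 tau2 => w w1 w2 t1 t2 tau1 tau2.
move: t1 t2 w1 w2; rewrite /T !mulrDr !mulr1 ![_ * M]mulrC => t1 t2 w1 w2.
by apply/andP; split; lra.
Qed.

Lemma Iop_bounded_necessary n (mu alpha beta p q B : R) :
  (0 < n)%N -> 1 < p -> p < q -> 0 < B ->
  (forall f : pt R n -> R, measurable_fun setT f ->
       (LnormP p (EFin \o f) < +oo)%E ->
       (LnormP q (Iop mu alpha beta f) <= B%:E * LnormP p (EFin \o f))%E) ->
  (alpha + beta) / (n%:R + 1) = p^-1 - q^-1.
Proof.
move=> n0 p1 pq B0 HB.
have p0 : 0 < p by exact: lt_trans p1.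
have q0 : 0 < q by exact: lt_trans pq.
have [T [c c0 Hc]] := @Iop_box_ge n mu alpha beta n0.
(* The homogeneous dimension: the test box has volume l^N. Comparing c l^(2(alpha+beta)) l^(N/q)
   with B l^(N/p) leaves the exponent [de]. *)
pose N : R := 2 * (n%:R + 1).
pose de := 2 * (alpha + beta) + N * (q^-1 - p^-1).
have key l : 0 < l -> c * l `^ de <= B.
  move=> l0; have ll0 : 0 < l * l by rewrite mulr_gt0.
  pose f := @box_indic n l.
  have mf : measurable_fun setT f.
    by apply: measurable_fun_ifT => //; exact: measurable_box.
  have lD e1 e2 : l `^ (e1 + e2) = l `^ e1 * l `^ e2.
    by rewrite powRD// (gt_eqF l0) implybT.
  have volE (k : R) : l ^+ n * (l ^+ n * (l * l * k)) = l `^ N * k.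
    have -> : N = n%:R + (n%:R + (1 + 1)) by rewrite /N; ring.
    rewrite !(lD n%:R) (lD 1) powRr1 ?(ltW l0)// !powR_mulrn ?(ltW l0)//.
    ring.
  have fp : LnormP p (EFin \o f) = (l `^ (N / p))%:E.
    rewrite /LnormP (_ : (fun x => _) = fun x => if box 0 l 0 (l * l) x then 1%:E else 0%E); last first.
      apply/funext => x; rewrite /f /box_indic/=; case: ifP => _; first by rewrite normr1 powR1.
      by rewrite normr0 powR0// gt_eqF.
    rewrite intP_box ?(ltW l0) ?(ltW ll0)// !subr0 volE mulr1 poweR_EFin.
    by rewrite -powRrM.
  have := HB f mf; rewrite fp ltry => /(_ isT) H.
  pose k := c * l `^ (2 * (alpha + beta)).
  have k0 : 0 < k by rewrite mulr_gt0// powR_gt0.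
  have lower : (((l `^ N * k `^ q) `^ q^-1)%:E <= LnormP q (Iop mu alpha beta f))%E.
    rewrite -poweR_EFin; apply: le_poweR; first by rewrite invr_ge0 ltW.
      by rewrite lee_fin mulr_ge0 ?powR_ge0.
    rewrite -volE.
    (* The shifted box, on which the lower bound holds, has the same sides l and l^2, hence again
       volume l^N. *)
    have e1 : l = 3 * l - 2 * l by ring.
    have e2 : l * l = l * l * (T + 1) - l * l * T by ring.
    rewrite [X in X ^+ n * (X ^+ n * _)]e1 [X in X * k `^ q]e2 -intP_box; last 2 first.
    - by lra.
    - by rewrite ler_pM2l// lerDl.
    apply: le_intP => x.
      by case: ifP => // _; rewrite lee_fin powR_ge0.
    case: ifPn => [bx|_]; last exact: poweR_ge0.
    rewrite -poweR_EFin; apply: le_poweR; first exact: ltW.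
      by rewrite lee_fin ltW.
    apply: le_trans (lee_abs _); exact: Hc.
  have {lower}H := le_trans lower H; move: H.
  rewrite -EFinM lee_fin powRM ?powR_ge0// -!powRrM divff ?gt_eqF// powRr1 ?(ltW k0)//.
  rewrite /k => H.
  rewrite /de mulrBr addrA powRB ?(gt_eqF l0) ?implybT//.
  rewrite mulrA ler_pdivrMr ?powR_gt0// powRD ?(gt_eqF l0) ?implybT//.
  by rewrite mulrA mulrC.
have de0 : de = 0.
  apply/eqP; apply: contraT => dn0.
  (* If [de] were nonzero, some l would make l^de equal to 2B/c, and [key] would read 2B <= B. *)
  have b0 : 0 < 2 * B / c by rewrite divr_gt0// mulr_gt0.
  have := key ((2 * B / c) `^ de^-1); rewrite powR_gt0// => /(_ isT).
  rewrite -powRrM mulVf// powRr1 ?(ltW b0)// mulrC divfK ?gt_eqF//.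
  by move=> B2; suff : False by []; lra.
have n1 : n%:R + 1 != 0 :> R by rewrite gt_eqF// ltr_wpDl.
apply: (mulIf n1); rewrite divfK//.
move: de0; rewrite /de /N; lra.
Qed.

End necessity.

Theorem mainTheorem1 (R : realType) (n : nat) (mu alpha beta p q : R) :
  (1 <= n)%N -> 1 < p -> p < q ->
  (exists B : R, 0 < B /\
     forall f : pt R n -> R, measurable_fun setT f ->
       (LnormP p (EFin \o f) < +oo)%E ->
       (LnormP q (Iop mu alpha beta f) <= B%:E * LnormP p (EFin \o f))%E)
  <-> (alpha + beta) / (n%:R + 1) = p^-1 - q^-1.
Proof.
move=> n1 p1 pq; split=> [[B [B0 HB]]|gE].
  exact: Iop_bounded_necessary n1 p1 pq B0 HB.
have [B [B0 HB]] := @Iop_bounded R n mu alpha beta p q p1 pq gE.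
by exists B; split=> // f mf _; exact: HB.
Qed.
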